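(* Let $R$ be an algebraically closed field of characteristic $\ne p$, and let $\mathrm{Rk}_R:\mathfrak K_R(G)\to\bar H_R$ be the rank map. Then the image of $\mathrm{Rk}_R$ is contained in $\bar H^c_R$; that is, the rank of every finitely generated projective smooth $R$-representation of $G$ is an element of the cocenter $\bar H_R$ that can be represented by a function supported in the subset of compact elements of $G$.
   Context: $F$ is a nonarchimedean local field of residual characteristic $p$, $\mathbb G$ a connected reductive group over $F$, $G=\mathbb G(F)$. $H_R$ is the convolution algebra of locally constant compactly supported $R$-valued functions on $G$ (Haar measure giving volume $1$ to a pro-$p$ Iwahori subgroup), and $\bar H_R=H_R/[H_R,H_R]$. An element of $G$ is compact if it lies in a compact subgroup of $G$; $\bar H_R^c\subset\bar H_R$ is the subspace of classes of functions in $H_R$ supported in the set of compact elements. $\mathfrak K_R(G)$ is the $R$-vector space with basis the isomorphism classes of indecomposable finitely generated projective objects in the category of smooth $R$-representations of $G$. Rank map: a finitely generated projective smooth representation $\Pi$ is isomorphic to a direct summand of $(H_Re_{\mathcal K})^n$ for some $n$ and some open pro-$p$ subgroup $\mathcal K$, where $e_{\mathcal K}=\mu(\mathcal K)^{-1}1_{\mathcal K}$; such a summand is the image of right multiplication by an idempotent $e=(e_{ij})\in M_n(e_{\mathcal K}H_Re_{\mathcal K})\subset M_n(H_R)$. Then $\mathrm{Rk}_R(\Pi)$ is the class of $\sum_i e_{ii}$ in $\bar H_R$ (independent of choices), extended $R$-linearly to $\mathfrak K_R(G)$. *)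

(* Defs.v *)
From HB Require Import structures.
From mathcomp Require Import all_boot all_order all_algebra.
From mathcomp Require Import generic_quotient ring_quotient.
From mathcomp Require Import boolp classical_sets functions.
From mathcomp Require Import topology numfun.
From mathcomp Require mpoly.
Import -(notations) mpoly.

Set Implicit Arguments.
Unset Strict Implicit.
Unset Printing Implicit Defensive.

Import Order.TTheory GRing.Theory Num.Theory.
Local Open Scope classical_set_scope.
Local Open Scope ring_scope.

(* The valuation [v] is only meaningful on nonzero elements;
   [val_ge v k x] reads "v(x) >= k", with v(0) = +oo. *)
Definition val_ge (F : fieldType) (v : F -> int) (k : int) (x : F) : Prop :=
  x = 0 \/ k <= v x.

Record localField := LocalField {
  lf_field :> fieldType;
  valuation : lf_field -> int;
  residue_char : nat;
  valuationM : forall x y, x != 0 -> y != 0 ->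
    valuation (x * y) = valuation x + valuation y;
  valuationD : forall x y, x != 0 -> y != 0 -> x + y != 0 ->
    Num.min (valuation x) (valuation y) <= valuation (x + y);
  valuation_normalized : exists2 x, x != 0 & valuation x = 1;
  valuation_complete : forall u : nat -> lf_field,
    (forall k, exists N, forall m n, (N <= m)%N -> (N <= n)%N ->
       val_ge valuation k (u m - u n)) ->
    exists l, forall k, exists N, forall n, (N <= n)%N ->
       val_ge valuation k (u n - l);
  residue_field_finite : exists s : seq lf_field,
    forall x, val_ge valuation 0 x -> exists2 y, y \in s &
      val_ge valuation 1 (x - y);
  residue_char_prime : prime residue_char;
  residue_charP : val_ge valuation 1 (residue_char%:R)
}.

Definition mx_eval (K : fieldType) (n : nat) (p : mpoly (n * n) K)
  (g : 'M[K]_n) : K := meval (fun i => mxvec g ord0 i) p.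

Definition generic_det (K : fieldType) (n : nat) : mpoly (n * n) K :=
  \det (\matrix_(i < n, j < n) mpolyX K (mnm1 (mxvec_index i j))).

Section Zariski.
Variables (K : fieldType) (n : nat).
Implicit Types A U Z : set 'M[K]_n.

Definition GLlocus (S : set (mpoly (n * n) K)) : set 'M[K]_n :=
  [set g | g \in unitmx /\ forall p, S p -> mx_eval p g = 0].

Definition zariski_closed A := exists S, A = GLlocus S.

Definition zariski_connected A :=
  A !=set0 /\
  forall Z1 Z2, zariski_closed Z1 -> zariski_closed Z2 ->
    A `<=` Z1 `|` Z2 -> A `&` Z1 `&` Z2 = set0 ->
    A `&` Z1 = set0 \/ A `&` Z2 = set0.

Definition GLsubgroup A :=
  [/\ A 1%:M, (forall g h, A g -> A h -> A (g *m h))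
    & (forall g, A g -> A (invmx g))].

Definition unipotent (u : 'M[K]_n) := exists k : nat, (u - 1%:M) ^+ k = 0.

Definition zariski_reductive A :=
  forall U, U `<=` A -> zariski_closed U -> GLsubgroup U ->
    zariski_connected U ->
    (forall g u, A g -> U u -> U (g *m u *m invmx g)) ->
    (forall u, U u -> unipotent u) ->
    U `<=` [set 1%:M].

End Zariski.

Definition geometric_points (F Fbar : fieldType) (iota : {rmorphism F -> Fbar})
  (n : nat) (eqs : seq (mpoly (n * n) F)) : set 'M[Fbar]_n :=
  GLlocus [set map_mpoly iota p | p in [set` eqs]].

(* A connected reductive group over [F], given as a closed subgroup of GL_n
   cut out by the polynomials [crg_eqs] over [F] in the matrix entries.
   [Fbar] is an algebraic closure of [F] (embedded by [iota]).
   [crg_reduced] says that [crg_eqs] generate, in Fbar[x_ij, 1/det], the full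
   vanishing ideal of the group of [Fbar]-points: the group is defined over [F]
   and smooth, hence it is determined by its [Fbar]-points together with its
   equations. *)
Record connectedReductiveGroup (F Fbar : fieldType) (iota : {rmorphism F -> Fbar}) :=
  ConnectedReductiveGroup {
  crg_dim : nat;
  crg_eqs : seq (mpoly (crg_dim * crg_dim) F);
  crg_subgroup : GLsubgroup (geometric_points iota crg_eqs);
  crg_reduced : forall q : mpoly (crg_dim * crg_dim) Fbar,
    (forall g, geometric_points iota crg_eqs g -> mx_eval q g = 0) ->
    exists (N : nat)
           (c : 'I_(size crg_eqs) -> mpoly (crg_dim * crg_dim) Fbar),
      generic_det Fbar crg_dim ^+ N * q =
      \sum_(i < size crg_eqs) c i * map_mpoly iota (crg_eqs`_i);
  crg_connected : zariski_connected (geometric_points iota crg_eqs);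
  crg_reductive : zariski_reductive (geometric_points iota crg_eqs)
}.

Section RationalPoints.
Variables (F : localField) (Fbar : fieldType) (iota : {rmorphism F -> Fbar}).
Variable GG : connectedReductiveGroup iota.

Definition rational_pred : {pred 'M[F]_(crg_dim GG)} :=
  [pred g | (g \in unitmx) && all (fun p => mx_eval p g == 0) (crg_eqs GG)].

Record rational_points := RationalPoint {
  rp_mx :> 'M[F]_(crg_dim GG);
  _ : rational_pred rp_mx }.

HB.instance Definition _ := [isSub for rp_mx].
HB.instance Definition _ := [Choice of rational_points by <:].

Lemma mx_eval_map n (p : mpoly (n * n) F) (g : 'M[F]_n) :
  mx_eval (map_mpoly iota p) (map_mx iota g) = iota (mx_eval p g).
Proof.
rewrite /mx_eval; elim/mpolyind: p => [|c m p _ _ IHp].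
  by rewrite /map_mpoly mmap0 !meval0 rmorph0.
have -> : map_mpoly iota (c *: mpolyX F m + p) =
    iota c *: mpolyX Fbar m + map_mpoly iota p.
  by rewrite -(map_mpolyX iota) -map_mpolyZ; exact: (raddfD (map_mpoly iota)).
rewrite !mevalD IHp !mevalZ !mevalX rmorphD rmorphM rmorph_prod.
congr (_ * _ + _); apply: eq_bigr => i _.
by rewrite rmorphXn -map_mxvec mxE.
Qed.

Lemma rational_predE g :
  rational_pred g <-> geometric_points iota (crg_eqs GG) (map_mx iota g).
Proof.
split.
  move=> /andP[gu /allP g0]; split; first by rewrite map_unitmx.
  by move=> _ [p /= /g0 /eqP pg <-]; rewrite mx_eval_map pg rmorph0.
move=> [gu g0]; apply/andP; split; first by rewrite map_unitmx in gu.
apply/allP => p pin; apply/eqP; apply: (fmorph_inj iota).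
by rewrite rmorph0 -mx_eval_map; apply: g0; exists p.
Qed.

Lemma rational1 : rational_pred 1%:M.
Proof. by apply/rational_predE; rewrite map_mx1; case: (crg_subgroup GG). Qed.

Lemma rationalM (g h : rational_points) : rational_pred (g *m h).
Proof.
apply/rational_predE; rewrite map_mxM; case: (crg_subgroup GG) => _ + _.
by apply; apply/rational_predE; [case: g | case: h].
Qed.

Lemma rationalV (g : rational_points) : rational_pred (invmx g).
Proof.
apply/rational_predE; rewrite map_invmx; case: (crg_subgroup GG) => _ _.
by apply; apply/rational_predE; case: g.
Qed.

Definition rational_one := RationalPoint rational1.
Definition rational_mul g h := RationalPoint (rationalM g h).
Definition rational_inv g := RationalPoint (rationalV g).

Lemma rational_unit (g : rational_points) : rp_mx g \in unitmx.
Proof. by case: g => g /= /andP[]. Qed.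

Lemma rational_mulA : associative rational_mul.
Proof. by move=> x y z; apply: val_inj; rewrite /= mulmxA. Qed.
Lemma rational_mul1 : left_id rational_one rational_mul.
Proof. by move=> x; apply: val_inj; rewrite /= mul1mx. Qed.
Lemma rational_mulr1 : right_id rational_one rational_mul.
Proof. by move=> x; apply: val_inj; rewrite /= mulmx1. Qed.
Lemma rational_mulV : left_inverse rational_one rational_inv rational_mul.
Proof. by move=> x; apply: val_inj; rewrite /= mulVmx ?rational_unit. Qed.
Lemma rational_mulVr : right_inverse rational_one rational_inv rational_mul.
Proof. by move=> x; apply: val_inj; rewrite /= mulmxV ?rational_unit. Qed.

HB.instance Definition _ := isGroup.Build rational_points
  rational_mulA rational_mul1 rational_mulr1 rational_mulV rational_mulVr.

(* The topology induced from M_n(F); on GL_n(F), inversion is continuous for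
   it, so det^-1 need not be added to the coordinates. *)
Definition rational_open (A : set rational_points) :=
  forall g, A g -> exists k : int, forall h : rational_points,
    (forall i j, val_ge (@valuation F) k (h i j - g i j)) -> A h.

Lemma val_ge_le (k l : int) (x : F) :
  k <= l -> val_ge (@valuation F) l x -> val_ge (@valuation F) k x.
Proof. by move=> kl [->|lx]; [left | right; apply: le_trans lx]. Qed.

Lemma rational_openT : rational_open setT.
Proof. by move=> g _; exists 0. Qed.

Lemma rational_openI : setI_closed rational_open.
Proof.
move=> A B oA oB g [/oA[k Ak] /oB[l Bl]]; exists (Num.max k l) => h hg.
split; [apply: Ak | apply: Bl] => i j; apply: val_ge_le (hg i j);
  by rewrite le_max lexx ?orbT.
Qed.

Lemma rational_open_bigU (I : Type) (f : I -> set rational_points) :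
  (forall i, rational_open (f i)) -> rational_open (\bigcup_i f i).
Proof.
move=> of_ g [i _ /of_[k fk]]; exists k => h hg; exists i => //.
exact: fk.
Qed.

HB.instance Definition _ := isOpenTopological.Build rational_points
  rational_openT rational_openI rational_open_bigU.

End RationalPoints.

(* No compatibility of the two structures is recorded; only groups of rational
   points are used, where the operations are continuous. *)
#[short(type="groupWithTopologyType")]
HB.structure Definition GroupWithTopology := {G of Group G & Topological G}.

HB.instance Definition _ (F : localField) (Fbar : fieldType)
  (iota : {rmorphism F -> Fbar}) (GG : connectedReductiveGroup iota) :=
  Group.on (rational_points GG).

Section Subgroups.
Variable G : groupWithTopologyType.
Implicit Types K L : set G.

Definition is_subgroup K :=
  [/\ K 1%g, (forall x y, K x -> K y -> K (x * y)%g)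
    & (forall x, K x -> K (x^-1)%g)].

Definition has_index K L (m : nat) :=
  exists t : 'I_m -> G, (forall i, K (t i)) /\
    forall x, K x -> exists! i, L ((t i)^-1 * x)%g.

Definition open_pro_p_subgroup (p : nat) K :=
  [/\ is_subgroup K, open K, compact K &
      forall L, is_subgroup L -> open L -> L `<=` K ->
        (forall x y, K x -> L y -> L (x * y * x^-1)%g) ->
        exists m : nat, has_index K L (p ^ m)].

Definition compact_element (g : G) :=
  exists C : set G, [/\ is_subgroup C, compact C & C g].

End Subgroups.

Section Hecke.
Variables (R : fieldType) (G : groupWithTopologyType).

Definition locally_constant (f : G -> R^o) :=
  forall x, \forall y \near x, f y = f x.

Definition compactly_supported (f : G -> R^o) :=
  compact (closure [set x | f x != 0]).

Definition hecke_pred : {pred G -> R^o} :=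
  [pred f | `[< locally_constant f /\ compactly_supported f >]].

Record hecke := Hecke { hecke_fun :> G -> R^o; _ : hecke_pred hecke_fun }.

HB.instance Definition _ := [isSub for hecke_fun].
HB.instance Definition _ := [Choice of hecke by <:].

Lemma hecke_submod_closed : submod_closed hecke_pred.
Proof.
split.
  apply/asboolP; split; first by move=> x; apply: filterE.
  rewrite /compactly_supported.
  suff -> : [set x : G | (0 : G -> R^o) x != 0] = set0.
    by rewrite closure0; exact: compact0.
  by apply/seteqP; split => x //=; rewrite eqxx.
move=> a f g /asboolP[lf cf] /asboolP[lg cg]; apply/asboolP; split.
  move=> x; apply: filterS2 (lf x) (lg x) => y fy gy.
  by rewrite !fctE /= fy gy.
apply: (@subclosed_compact _ _ _ (@closed_closure _ _) (compactU cf cg)).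
rewrite -closureU; apply: closureS => x /= fgx.
have [fx0|fx] := eqVneq (f x) 0; [right | by left].
by apply: contra_neq fgx => gx0; rewrite !fctE /= fx0 gx0 scaler0 addr0.
Qed.

HB.instance Definition _ :=
  GRing.isSubmodClosed.Build R (G -> R^o) hecke_pred hecke_submod_closed.
HB.instance Definition _ := [SubChoice_isSubLmodule of hecke by <:].

(* A left Haar measure with values in R, as the linear form
   f |-> \int_G f(x) dx on locally constant compactly supported functions;
   the values of [I] on other functions are never used. *)
Definition haar_integral (I : (G -> R^o) -> R) :=
  [/\ forall (a : R) (f g : hecke), I (a *: f + g)%R = a * I f + I g,
      forall (y : G) (f : hecke), I (fun x => f (y^-1 * x)%g) = I f
    & exists f : hecke, I f != 0].

Variable I : (G -> R^o) -> R.

Definition convolution (f g : G -> R^o) : G -> R^o :=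
  fun x => I (fun y => f y * g (y^-1 * x)%g).

Definition idem (K : set G) : G -> R^o := (I \1_K)^-1 *: (\1_K : G -> R^o).

(* [H, H], the linear span of the commutators. [convolution] is defined on raw
   functions; it maps Hecke functions to Hecke functions when G is a
   topological group, so every f ** g - g ** f is one of the generators. *)
Definition commutator_pred : {pred hecke} :=
  [pred h : hecke | `[< exists s : seq (R * hecke),
     (forall c, c \in s -> exists f g : hecke,
        (c.2 : G -> R^o) = convolution f g - convolution g f) /\
     h = \sum_(c <- s) c.1 *: c.2 >]].

Lemma commutator_submod_closed : submod_closed commutator_pred.
Proof.
split; first by apply/asboolP; exists [::]; split=> //; rewrite big_nil.
move=> a f g /asboolP[s [sP ->]] /asboolP[t [tP ->]]; apply/asboolP.
exists ([seq (a * c.1, c.2) | c <- s] ++ t); split.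
  by move=> c; rewrite mem_cat => /orP[/mapP[d /sP dP ->]|/tP].
rewrite big_cat big_map /= scaler_sumr; congr (_ + _).
by apply: eq_bigr => c _; rewrite scalerA.
Qed.

HB.instance Definition _ :=
  GRing.isSubmodClosed.Build R hecke commutator_pred commutator_submod_closed.

Definition cocenter := Quotient.quot commutator_pred.

HB.instance Definition _ := GRing.Zmodule.on cocenter.

Definition cocenter_class (h : hecke) : cocenter := (\pi_cocenter h)%qT.

Definition cocenter_scale (a : R) (x : cocenter) : cocenter :=
  cocenter_class (a *: (repr x)).

Lemma cocenter_classP f g :
  cocenter_class f = cocenter_class g <-> f - g \in commutator_pred.
Proof.
by rewrite (Quotient.idealrBE commutator_pred); split => [/eqP|/eqP].
Qed.

Lemma cocenter_classD f g :
  cocenter_class (f + g) = cocenter_class f + cocenter_class g.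
Proof. by rewrite /cocenter_class !piE. Qed.

Lemma cocenter_scale_class a f :
  cocenter_scale a (cocenter_class f) = cocenter_class (a *: f).
Proof.
apply/cocenter_classP; rewrite -scalerBr rpredZ //.
by apply/cocenter_classP; rewrite /cocenter_class reprK.
Qed.

Lemma cocenter_classK x : cocenter_class (repr x) = x.
Proof. by rewrite /cocenter_class reprK. Qed.

Lemma cocenter_scaleA a b x :
  cocenter_scale a (cocenter_scale b x) = cocenter_scale (a * b) x.
Proof. by rewrite -[x]cocenter_classK !cocenter_scale_class scalerA. Qed.
Lemma cocenter_scale1 : left_id 1 cocenter_scale.
Proof. by move=> x; rewrite -[x]cocenter_classK cocenter_scale_class scale1r. Qed.
Lemma cocenter_scaleDr : right_distributive cocenter_scale +%R.
Proof.
move=> a x y; rewrite -[x]cocenter_classK -[y]cocenter_classK.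
by rewrite -cocenter_classD !cocenter_scale_class -cocenter_classD scalerDr.
Qed.
Lemma cocenter_scaleDl x : {morph cocenter_scale^~ x : a b / a + b}.
Proof.
move=> a b; rewrite -[x]cocenter_classK !cocenter_scale_class.
by rewrite -cocenter_classD scalerDl.
Qed.

HB.instance Definition _ := GRing.Zmodule_isLmodule.Build R cocenter
  cocenter_scaleA cocenter_scale1 cocenter_scaleDr cocenter_scaleDl.

Definition compact_cocenter : set cocenter :=
  [set cocenter_class f | f in
    [set f : hecke | forall g : G, f g != 0 -> compact_element g]].

End Hecke.

Arguments compact_cocenter {R G} I _.

Section SmoothRepresentations.
Variables (R : fieldType) (G : groupWithTopologyType).

Record smoothRep := SmoothRep {
  rep_space :> lmodType R;
  rep_act : G -> rep_space -> rep_space;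
  rep_actP : forall g, linear (rep_act g);
  rep_act1 : forall v, rep_act 1%g v = v;
  rep_actM : forall g h v, rep_act (g * h)%g v = rep_act g (rep_act h v);
  rep_smooth : forall v, open [set g | rep_act g v = v]
}.

Implicit Types V W P : smoothRep.

Definition equivariant V W (f : V -> W) :=
  forall g v, f (rep_act g v) = rep_act g (f v).

Definition rep_iso V W :=
  exists f : {linear V -> W}, equivariant f /\ bijective f.

Definition finitely_generated V :=
  exists s : seq V, forall v, exists t : seq (R * G * V),
    (forall c, c \in t -> c.2 \in s) /\
    v = \sum_(c <- t) c.1.1 *: rep_act c.1.2 c.2.

Definition projective P :=
  forall V W (f : {linear V -> W}) (g : {linear P -> W}),
    equivariant f -> (forall w, exists v, f v = w) -> equivariant g ->
    exists2 h : {linear P -> V}, equivariant h & forall x, f (h x) = g x.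

Definition subrep V (A : set V) :=
  [/\ A 0, (forall a u v, A u -> A v -> A (a *: u + v))
    & (forall g v, A v -> A (rep_act g v))].

Definition indecomposable V :=
  (exists v : V, v != 0) /\
  forall A B : set V, subrep A -> subrep B ->
    (forall v, exists a b, [/\ A a, B b & v = a + b]) ->
    A `&` B = [set 0] -> A = [set 0] \/ B = [set 0].

Definition indec_class :=
  {C : smoothRep -> Prop | exists P, [/\ indecomposable P,
     finitely_generated P, projective P & C = rep_iso P]}.

(* The R-vector space with basis [indec_class], as the finitely supported
   functions on it. [smoothRep] lives in a larger universe than the carriers of
   MathComp structures, hence no lmodType instance here. *)
Definition projSpace :=
  {x : indec_class -> R | exists (n : nat) (s : 'I_n -> indec_class),
     forall C, x C != 0 -> exists i, s i = C}.

End SmoothRepresentations.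

Section Rank.
Variables (p : nat) (R : fieldType) (G : groupWithTopologyType).
Variable I : (G -> R^o) -> R.

Local Notation "f ** g" := (convolution I f g) (at level 40, left associativity).

(* [presents K e P] says that e is an idempotent of M_n(e_K H e_K), and P is isomorphic
   to the image of right multiplication by e on (H e_K)^n, on which G acts by
   left translation; [phi] is the isomorphism composed with the inclusion of
   this image into the space of n-tuples of functions. *)
Definition presents n (K : set G) (e : 'I_n -> 'I_n -> hecke R G)
    (P : smoothRep R G) :=
  [/\ forall i j, exists f : hecke R G,
        (e i j : G -> R^o) = idem I K ** f ** idem I K,
      forall i j, (e i j : G -> R^o) = \sum_(k < n) (e i k ** e k j)
    & exists phi : {linear P -> ('I_n -> G -> R^o)},
        [/\ injective phi,
            forall g v, phi (rep_act g v) = (fun j x => phi v j (g^-1 * x)%g)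
          & range phi = [set F | exists u : 'I_n -> hecke R G,
              forall j, F j = \sum_(i < n) (u i ** idem I K ** e i j)]]].

Definition is_rank (P : smoothRep R G) (h : cocenter I) :=
  exists (n : nat) (K : set G) (e : 'I_n -> 'I_n -> hecke R G),
    [/\ open_pro_p_subgroup p K, presents K e P
      & h = cocenter_class I (\sum_(i < n) e i i)].

(* For P finitely generated projective [is_rank P] is a singleton depending
   only on the isomorphism class of P, so the default value is never used. *)
Definition rank_class (C : smoothRep R G -> Prop) : cocenter I :=
  xget 0 [set h | exists2 P, C P & is_rank P h].

(* Linear extension: the sum of x(C) rank(C) over the finite support of x. *)
Definition rank_map (x : projSpace R G) : cocenter I :=
  xget 0 [set h | exists (n : nat) (s : 'I_n -> indec_class R G),
    [/\ injective s, forall C, sval x C != 0 -> exists i, s i = C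
      & h = \sum_(i < n) sval x (s i) *: rank_class (sval (s i))]].

End Rank.

(* Main.v *)
(* Idea. For g in GL_n(F) let B(g) be the space of row vectors with bounded
   forward orbit under g. Then g expands F^n / B(g), and the logarithm c(g, h)
   of the factor by which h changes volumes from F^n / B(g) to
   F^n / B(h^-1 g h) is a locally constant cocycle. Its value w(g) = c(g, g) on
   loops is a class function with w(g^m) = m w(g), and g is compact as soon as
   w(g) = w(g^-1) = 0. The level sets of w being open, closed and conjugation
   invariant, the cocenter is graded by w, and it remains to see that the rank
   r of an idempotent e has no component r_mu with mu <> 0.
   - In characteristic 0, expand e = e e and e = e e e over cyclic words of
     cosets and weight each word by the value of c on its first letter. The
     weights of the rotations of a word add up to mu, and the two weighted sums
     T agree since e e = e; hence 2 T = mu r_mu = 3 T, so that mu r_mu = 0.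
   - In characteristic l, expand e = e^m with m = l^k over words of length m.
     Non-constant words come in rotation orbits whose length is a multiple of l,
     and a constant word lives in the levels w in m Z, so r_mu = 0 if m > |mu|. *)

Require Import Defs.
From HB Require Import structures.
From mathcomp Require Import all_boot all_order all_algebra.
From mathcomp Require Import fingroup perm action cyclic zify ring.
From mathcomp Require Import boolp classical_sets functions.
From mathcomp Require Import topology numfun.
From mathcomp Require mpoly.
Import -(notations) mpoly.

Set Implicit Arguments.
Unset Strict Implicit.
Unset Printing Implicit Defensive.

Import Order.TTheory GRing.Theory Num.Theory.
Local Open Scope ring_scope.

(** * Traces of idempotents *)

(** Over an algebraic closure, B(g) is the sum of the generalised eigenspaces whose eigenvalue has
    absolute value at most 1. For a nonarchimedean absolute value this condition is both open and
    closed, so B(g) deforms continuously with g; this makes c locally constant and is the main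
    analytic work.

    A cocycle is wanted, and not just the class function w, because the weight of a cyclic word has
    to be shared among its letters. The resulting relation mu r_mu = 0 says nothing in
    characteristic l when l divides mu, whence the separate argument by rotation orbits.

    The condition w(g) = 0 only bounds the forward orbits of g, and a contracting scalar satisfies
    it. The argument is therefore run a second time with the cocycle c(g^-1, h), and the two
    truncations are composed. Composing them makes sense because multiplication by a locally
    constant class function preserves the span of commutators.

    Integrals become finite sums: Hecke functions are split into cosets of a compact open subgroup
    so small that the levels and weights in play are constant on the relevant products of cosets. *)

(** Orbits have [p]-power size, and [f] is constant on each; an orbit with more than one point
    contributes a multiple of [p], which vanishes in [M]. *)
Lemma sum_perm_fixed (M : nmodType) (T : finType) (s : {perm T}) (f : T -> M) p k :
  prime p -> (forall y : M, y *+ p = 0) -> (s ^+ (p ^ k) = 1)%g ->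
  (forall x, f (s x) = f x) -> \sum_x f x = \sum_(x | s x == x) f x.
Proof.
move=> pp Mp sp fs.
have fsX x i : f ((s ^+ i)%g x) = f x.
  by elim: i => [|i IH]; rewrite ?expg0 ?perm1// expgSr permM fs.
rewrite (partition_big (porbit s) predT)//= [RHS](partition_big (porbit s) predT)//=.
apply: eq_bigr => A _.
have [y /eqP <-|A0] := pickP (fun y => porbit s y == A); last first.
  by rewrite !big_pred0// => x; rewrite ?A0 ?andbF.
rewrite [RHS]big_mkcondl/=.
have fE x : porbit s x == porbit s y -> f x = f y.
  by rewrite eq_porbit_mem => /porbitP[i ->].
have fixE x : porbit s x == porbit s y -> (s x == x) = (s y == y).
  rewrite eq_porbit_mem => /porbitP[i ->]; rewrite -permM -expgSr expgS permM.
  by rewrite (inj_eq perm_inj).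
transitivity (f y *+ #|porbit s y|).
  rewrite -sumr_const; apply: eq_big => [x|x /fE//].
  by rewrite eq_porbit_mem.
have [sy|sy] := eqVneq (s y) y.
  have -> : #|porbit s y| = 1%N.
    rewrite (_ : porbit s y = [set y]) ?cards1//; apply/setP => x; rewrite inE.
    apply/porbitP/eqP => [[i ->]|->]; last by exists 0%N; rewrite expg0 perm1.
    by elim: i => [|i IH]; rewrite ?expg0 ?perm1// expgSr permM IH.
  rewrite mulr1n (big_pred1 y) ?sy ?eqxx// => x /=.
  rewrite eq_porbit_mem; apply/porbitP/eqP => [[i ->]|->]; last first.
    by exists 0%N; rewrite expg0 perm1.
  by elim: i => [|i IH]; rewrite ?expg0 ?perm1// expgSr permM IH.
rewrite big1; last by move=> x hx; rewrite (fixE x hx) (negPf sy).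
have : (#|porbit s y| %| p ^ k)%N.
  rewrite porbitE card_orbit; apply: dvdn_trans (dvdn_indexg _ _) _.
  by rewrite -orderE order_dvdn sp.
move=> /(dvdn_pfactor _ _ pp)[[|j] _ cE]; last first.
  by rewrite cE expnS mulrnA Mp mul0rn.
have /eqP/cards1P[z zE] := cE.
have := porbit_id s y; have := mem_porbit s 1 y; rewrite expg1 zE !inE.
by move=> /eqP syz /eqP yz; rewrite syz yz eqxx in sy.
Qed.

Section TraceAlgebra.
Variables (R : comNzRingType) (V M : lmodType R) (mul : V -> V -> V) (tr : V -> M).
Hypothesis mulDl : forall (J : finType) (E : J -> R) (U : J -> V) y,
  mul (\sum_j E j *: U j) y = \sum_j E j *: mul (U j) y.
Hypothesis mulDr : forall (J : finType) (E : J -> R) (U : J -> V) x,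
  mul x (\sum_j E j *: U j) = \sum_j E j *: mul x (U j).
Hypothesis mulA : forall x y z, mul x (mul y z) = mul (mul x y) z.
Hypothesis tr_sum : forall (J : finType) (E : J -> R) (U : J -> V),
  tr (\sum_j E j *: U j) = \sum_j E j *: tr (U j).
Hypothesis trC : forall x y, tr (mul x y) = tr (mul y x).

(** The algebra is not assumed to have a unit, so words are nonempty: the first letter is a separate
    argument and the list holds the remaining ones. *)
Fixpoint word_product (b : V) (l : seq V) : V :=
  if l is c :: l' then mul b (word_product c l') else b.

Lemma word_product_cat b l c l' :
  word_product b (l ++ c :: l') = mul (word_product b l) (word_product c l').
Proof. by elim: l b => //= d l IH b; rewrite IH mulA. Qed.

Lemma tr_word_product_rot b l c : tr (word_product b (rcons l c)) = tr (word_product c (b :: l)).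
Proof. by rewrite -cats1 word_product_cat /= trC. Qed.

Variables (B : finType) (E : B -> R) (U : B -> V) (e : V).
Hypothesis eE : e = \sum_b E b *: U b.
Hypothesis ee : e = mul e e.

Definition tuple_product m (t : m.+1.-tuple B) : V :=
  word_product (U (thead t)) (map U (behead t)).

Lemma tuple_productS m b (t : m.+1.-tuple B) :
  tuple_product [tuple of b :: t] = mul (U b) (tuple_product t).
Proof. by case/tupleP: t => c t; rewrite /tuple_product !theadE. Qed.

Lemma idempotent_words m :
  e = \sum_(t : m.+1.-tuple B) (\prod_(b <- t) E b) *: tuple_product t.
Proof.
elim: m => [|m IH].
  rewrite eE (reindex (fun b => [tuple b])) /=; last first.
    exists (fun t => thead t) => [b _|t _]; first by rewrite theadE.
    by apply: val_inj; case: t => [[|b [|]]].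
  by apply: eq_bigr => b _; rewrite big_seq1 /tuple_product theadE.
rewrite [in LHS]ee {1}eE mulDl (reindex (fun p : B * m.+1.-tuple B => [tuple of p.1 :: p.2])) /=.
  rewrite -(pair_bigA _ (fun b (t : m.+1.-tuple B) =>
    (\prod_(c <- [tuple of b :: t]) E c) *: tuple_product [tuple of b :: t]))/=.
  apply: eq_bigr => b _; rewrite {1}IH mulDr scaler_sumr; apply: eq_bigr => t _.
  by rewrite tuple_productS big_cons scalerA.
exists (fun t => (thead t, [tuple of behead t])) => [[b t] _|t _] /=.
  by rewrite theadE; congr (_, _); apply: val_inj.
by rewrite -tuple_eta.
Qed.

Definition rot_tuple m (t : m.-tuple B) : m.-tuple B := [tuple of rot 1 t].

Lemma rot_tuple_inj m : injective (@rot_tuple m).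
Proof. by move=> s t /(congr1 val) /rot_inj /val_inj. Qed.

Lemma tr_tuple_product_rot m (t : m.+1.-tuple B) :
  tr (tuple_product (rot_tuple t)) = tr (tuple_product t).
Proof.
case: t => [[|b [|c l]] sl] //.
rewrite /tuple_product (_ : thead _ = c)// (_ : behead _ = rcons l b); last first.
  by rewrite -cats1.
by rewrite map_rcons tr_word_product_rot.
Qed.

Lemma prod_rot m (t : m.-tuple B) : \prod_(b <- rot_tuple t) E b = \prod_(b <- t) E b.
Proof. by apply: perm_big; rewrite perm_rot. Qed.

(* Rotation acts on the words of length [p ^ k], and the orbits of non-constant
   words contribute multiples of [p]. *)
Lemma tr_idempotent_frobenius p k : prime p -> (forall y : M, y *+ p = 0) ->
  tr e = \sum_b E b ^+ (p ^ k) *: tr (word_product (U b) (nseq (p ^ k).-1 (U b))).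
Proof.
move=> pp Mp; have pk0 : (0 < p ^ k)%N by rewrite expn_gt0 prime_gt0.
have := prednK pk0; set m := (p ^ k).-1 => pkm.
rewrite {1}(idempotent_words m) tr_sum.
pose s : {perm m.+1.-tuple B} := perm (@rot_tuple_inj m.+1).
have sX t i : (i <= m.+1)%N -> val ((s ^+ i)%g t) = rot i t.
  elim: i => [|i IH] im; first by rewrite expg0 perm1 rot0.
  rewrite expgSr permM permE /= IH ?(ltnW im)//. by rewrite (@rotS _ i t) ?size_tuple.
rewrite (@sum_perm_fixed _ _ s _ p k pp Mp); last first.
- by move=> t; rewrite permE prod_rot tr_tuple_product_rot.
- apply/permP => t; apply: val_inj; rewrite -pkm sX// perm1.
  by rewrite rot_oversize// size_tuple.
(* A word fixed by rotation by one place has equal consecutive letters, so the fixed words are the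
   constant ones and are indexed by their letter. *)
rewrite (reindex_onto (fun b => [tuple of nseq m.+1 b]) (fun t => thead t))/=; last first.
  move=> t /eqP st; apply: val_inj => /=; apply/esym.
  have tE i : (i < m)%N -> nth (thead t) t i.+1 = nth (thead t) t i.
    move=> im; have := congr1 (fun u : m.+1.-tuple B => nth (thead t) u i) st.
    rewrite permE /= /rot nth_cat size_drop size_tuple subn1 /= im nth_drop add1n.
    by [].
  rewrite -[_ :: _]/(nseq m.+1 (thead t)).
  apply: (@eq_from_nth _ (thead t)); first by rewrite size_tuple size_nseq.
  move=> i; rewrite size_tuple => im.
  rewrite nth_nseq im.
  elim: i im => [|i IH] im; first by rewrite (tuple_eta t) theadE.
  by rewrite tE ?IH// ltnW.
apply: eq_big => [b|b _].
  rewrite (_ : thead _ = b)// eqxx andbT; apply/eqP; apply: val_inj; rewrite permE /=.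
  by rewrite rot1_cons -cats1 -(nseqD m 1) addn1.
rewrite -pkm /tuple_product (_ : thead _ = b)// (_ : behead _ = nseq m b)// map_nseq; congr (_ *: _).
by rewrite -[LHS]/(\prod_(c <- nseq m.+1 b) E c) big_nseq iter_mulr_1.
Qed.

(* With T the weighted sum over words of length two, or equally three, the
   conclusion is 2 T = mu r = 3 T; nothing needs to be invertible in R. *)
Lemma cyclic_weight_eq0 (W2 J2 : B -> B -> R) (W3 J3 : B -> B -> B -> R) (mu : R) (r : M) :
  (forall b c, W2 b c + W2 c b = mu * J2 b c) ->
  (forall b c d, W3 b c d + W3 c d b + W3 d b c = mu * J3 b c d) ->
  (forall b, \sum_c \sum_d (E c * E d * W3 b c d) *: mul (U c) (U d) =
             \sum_c (E c * W2 b c) *: U c) ->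
  \sum_b \sum_c (E b * E c * J2 b c) *: tr (mul (U b) (U c)) = r ->
  \sum_b \sum_c \sum_d (E b * E c * E d * J3 b c d) *: tr (mul (U b) (mul (U c) (U d))) = r ->
  mu *: r = 0.
Proof.
move=> h2 h3 hc r2 r3.
pose T2 := \sum_b \sum_c (E b * E c * W2 b c) *: tr (mul (U b) (U c)).
pose t3 b c d := tr (mul (U b) (mul (U c) (U d))).
have t3C b c d : t3 b c d = t3 c d b by rewrite /t3 trC mulA.
pose T3 := \sum_b \sum_c \sum_d (E b * E c * E d * W3 b c d) *: t3 b c d.
have e2 : T2 + T2 = mu *: r.
  rewrite -r2 scaler_sumr {2}/T2 exchange_big -big_split/=; apply: eq_bigr => b _.
  rewrite scaler_sumr -big_split/=; apply: eq_bigr => c _.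
  rewrite (trC (U c)) -scalerDl scalerA; congr (_ *: _).
  by rewrite mulrCA -h2 [E c * _]mulrC mulrDr.
have cyc (g : B -> B -> B -> M) :
    \sum_b \sum_c \sum_d g c d b = \sum_b \sum_c \sum_d g b c d.
  rewrite exchange_big; apply: eq_bigr => c _; exact: exchange_big.
pose f (W : B -> B -> B -> R) b c d := (E b * E c * E d * W b c d) *: t3 b c d.
have fC (W : B -> B -> B -> R) b c d : f W c d b = f (fun b c d => W c d b) b c d.
  by rewrite /f [t3 b c d]t3C; congr (_ * _ *: _); rewrite [LHS]mulrC mulrA.
have T3C (W : B -> B -> B -> R) : \sum_b \sum_c \sum_d f W b c d =
    \sum_b \sum_c \sum_d f (fun b c d => W c d b) b c d.
  rewrite -(cyc (f W)); apply: eq_bigr => b _; apply: eq_bigr => c _.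
  by apply: eq_bigr => d _; exact: fC.
have e3 : T3 + T3 + T3 = mu *: r.
  pose W1 b c d := W3 c d b; pose W2' b c d := W1 c d b.
  have e1 : T3 = \sum_b \sum_c \sum_d f W1 b c d by exact: T3C.
  have e1' : T3 = \sum_b \sum_c \sum_d f W2' b c d by rewrite e1; exact: T3C.
  rewrite {3}e1' {2}e1 -r3 scaler_sumr -!big_split/=.
  apply: eq_bigr => b _; rewrite scaler_sumr -!big_split/=; apply: eq_bigr => c _.
  rewrite scaler_sumr -!big_split/=; apply: eq_bigr => d _.
  rewrite /f -/(t3 b c d) -!scalerDl -!mulrDr h3 scalerA; congr (_ *: _).
  by rewrite mulrCA.
(* By [hc], contracting the last two letters, that is using e e = e there, turns the three-letter
   weights into the two-letter ones. *)
have e23 : T3 = T2.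
  have trE (b : B) : \sum_c \sum_d (E b * E c * E d * W3 b c d) *: t3 b c d =
      E b *: tr (mul (U b) (\sum_c \sum_d (E c * E d * W3 b c d) *: mul (U c) (U d))).
    rewrite [in RHS]pair_bigA/= mulDr tr_sum scaler_sumr [LHS]pair_bigA/=.
    by apply: eq_bigr => -[c d] _; rewrite scalerA !mulrA.
  apply: eq_bigr => b _; rewrite trE hc mulDr tr_sum scaler_sumr.
  by apply: eq_bigr => c _; rewrite scalerA mulrA.
(* Both [T2 + T2] and [T2 + T2 + T2] equal [mu *: r]. *)
have T0 : T2 = 0.
  by move: e3; rewrite e23 -e2 => /(canRL (addKr _)); rewrite addNr.
by rewrite -e2 T0 addr0.
Qed.

End TraceAlgebra.

Local Open Scope classical_set_scope.
Local Open Scope ring_scope.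

(** * Matrices over a local field *)

Section LocalField.
Variable F : localField.
Local Notation v := (@valuation F).
Local Notation vge := (val_ge v).
Implicit Types x y z : F.

Lemma valuation1 : v 1 = 0.
Proof.
have := valuationM (oner_neq0 F) (oner_neq0 F); rewrite mulr1; move: (v 1) => a h. 
lia.
Qed.

Lemma valuationV x : x != 0 -> v x^-1 = - v x.
Proof.
move=> x0; have := valuationM x0 (invr_neq0 x0).
rewrite mulfV// valuation1; lia.
Qed.

Lemma valuationX x n : x != 0 -> v (x ^+ n) = v x *+ n.
Proof.
move=> x0; elim: n => [|n IH]; first by rewrite expr0 valuation1.
by rewrite exprS valuationM ?expf_neq0// IH mulrS.
Qed.

Lemma valuationN x : v (- x) = v x.
Proof.
have [->|x0] := eqVneq x 0; first by rewrite oppr0.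
have N1 : v (-1) = 0.
  have n1 : (-1 : F) != 0 by rewrite oppr_eq0 oner_neq0.
  by have := valuationM n1 n1; rewrite mulrNN mulr1 valuation1; lia.
by rewrite -mulN1r valuationM ?N1 ?add0r// oppr_eq0 oner_neq0.
Qed.

Lemma val_geE k x : x != 0 -> vge k x <-> k <= v x.
Proof. by move=> x0; split=> [[x0'|//]|]; [rewrite x0' eqxx in x0|right]. Qed.

Lemma val_geW k l x : k <= l -> vge l x -> vge k x.
Proof. exact: val_ge_le. Qed.

Lemma val_geN k x : vge k (- x) <-> vge k x.
Proof.
have [->|x0] := eqVneq x 0; first by rewrite oppr0.
by rewrite !val_geE ?oppr_eq0// valuationN.
Qed.

Lemma val_geD k x y : vge k x -> vge k y -> vge k (x + y).
Proof.
have [->|x0] := eqVneq x 0; first by rewrite add0r.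
have [->|y0] := eqVneq y 0; first by rewrite addr0.
have [->|xy0] := eqVneq (x + y) 0; first by left.
move=> /(val_geE _ x0) kx /(val_geE _ y0) ky; right.
by apply: le_trans (valuationD x0 y0 xy0); rewrite le_min kx.
Qed.

Lemma val_geB k x y : vge k x -> vge k y -> vge k (x - y).
Proof. by move=> kx ky; apply: val_geD => //; apply/val_geN. Qed.

Lemma val_geM k l x y : vge k x -> vge l y -> vge (k + l) (x * y).
Proof.
have [->|x0] := eqVneq x 0; first by rewrite mul0r; left.
have [->|y0] := eqVneq y 0; first by rewrite mulr0; left.
move=> /(val_geE _ x0) kx /(val_geE _ y0) ky; right.
by rewrite valuationM// lerD.
Qed.

Lemma val_ge_sum (J : Type) (r : seq J) (P : pred J) (f : J -> F) k :
  (forall i, P i -> vge k (f i)) -> vge k (\sum_(i <- r | P i) f i).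
Proof. by move=> h; elim/big_ind: _ => //; [left|move=> x y; exact: val_geD]. Qed.

Lemma val_ge1 : vge 0 1.
Proof. by right; rewrite valuation1. Qed.

Lemma val_ge_eq0 x : (forall k, vge k x) -> x = 0.
Proof.
move=> h; apply/eqP/negPn/negP => x0.
by move: (h (v x + 1)) => /(val_geE _ x0); lia.
Qed.

Lemma val_ge_exists x : exists2 k, k <= 0 & vge k x.
Proof.
exists (Num.min 0 (v x)); first by rewrite ge_min lexx.
by right; rewrite ge_min lexx orbT.
Qed.

Lemma val_ge_sym k x y : vge k (x - y) -> vge k (y - x).
Proof. by rewrite -(opprB y) => /val_geN. Qed.

Lemma val_ge_trans k x y z : vge k (x - y) -> vge k (y - z) -> vge k (x - z).
Proof. by move=> h1 h2; rewrite -(subrKA y); apply: val_geD. Qed.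

Lemma valuation_surj k : exists2 p : F, p != 0 & v p = k.
Proof.
have [pi pi0 vpi] := valuation_normalized F.
have hpi (j : nat) : pi ^+ j != 0 by rewrite expf_neq0.
have vpij (j : nat) : v (pi ^+ j) = j%:Z by rewrite valuationX// vpi natz.
case: k => j; first by exists (pi ^+ j).
by exists (pi ^+ j.+1)^-1; rewrite ?invr_eq0// valuationV// vpij.
Qed.

Definition mx_ge m n k (A : 'M[F]_(m, n)) := forall i j, vge k (A i j).

Lemma mx_ge0 m n k : mx_ge k (0 : 'M_(m, n)).
Proof. by move=> i j; rewrite mxE; left. Qed.

Lemma mx_geW m n k l (A : 'M_(m, n)) : k <= l -> mx_ge l A -> mx_ge k A.
Proof. by move=> kl h i j; apply: val_geW (h i j). Qed.

Lemma mx_geN m n k (A : 'M_(m, n)) : mx_ge k (- A) <-> mx_ge k A.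
Proof. by split=> h i j; move: (h i j); rewrite mxE => /val_geN. Qed.

Lemma mx_geD m n k (A B : 'M_(m, n)) : mx_ge k A -> mx_ge k B -> mx_ge k (A + B).
Proof. by move=> a b i j; rewrite mxE; apply: val_geD. Qed.

Lemma mx_geB m n k (A B : 'M_(m, n)) : mx_ge k A -> mx_ge k B -> mx_ge k (A - B).
Proof. by move=> a b; apply: mx_geD => //; apply/mx_geN. Qed.

Lemma mx_ge_sym m n k (A B : 'M_(m, n)) : mx_ge k (A - B) -> mx_ge k (B - A).
Proof. by rewrite -(opprB B) => /mx_geN. Qed.

Lemma mx_ge_trans m n k (A B C : 'M_(m, n)) :
  mx_ge k (A - B) -> mx_ge k (B - C) -> mx_ge k (A - C).
Proof. by move=> h1 h2; rewrite -(subrKA B); apply: mx_geD. Qed.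

Lemma mx_ge_sum m n (J : Type) (r : seq J) (P : pred J) (f : J -> 'M_(m, n)) k :
  (forall i, P i -> mx_ge k (f i)) -> mx_ge k (\sum_(i <- r | P i) f i).
Proof.
by move=> h; elim/big_ind: _ => //; [exact: mx_ge0|move=> x y; exact: mx_geD].
Qed.

Lemma mx_geM m n p k l (A : 'M_(m, n)) (B : 'M_(n, p)) :
  mx_ge k A -> mx_ge l B -> mx_ge (k + l) (A *m B).
Proof. by move=> a b i j; rewrite mxE; apply: val_ge_sum => r _; apply: val_geM. Qed.

Lemma mx_ge1 n : mx_ge 0 (1%:M : 'M_n).
Proof. by move=> i j; rewrite mxE; case: eqP => _; [exact: val_ge1|left]. Qed.

Lemma mx_geZ m n k l a (A : 'M_(m, n)) : vge k a -> mx_ge l A -> mx_ge (k + l) (a *: A).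
Proof. by move=> ha hA i j; rewrite mxE; apply: val_geM. Qed.

Lemma mx_ge_eq0 m n (A : 'M_(m, n)) : (forall k, mx_ge k A) -> A = 0.
Proof.
move=> h; apply/matrixP => i j; rewrite mxE; apply: val_ge_eq0 => k; exact: h.
Qed.

(** The bound is written [- N] with [N] nonnegative so that several bounds can be merged by adding
    their exponents. *)
Lemma mx_ge_exists m n (A : 'M_(m, n)) : exists2 N : int, 0 <= N & mx_ge (- N) A.
Proof.
have /choice[f fP] : forall ij : 'I_m * 'I_n, exists N : int, 0 <= N /\ vge (- N) (A ij.1 ij.2).
  move=> ij; have [k k0 kP] := val_ge_exists (A ij.1 ij.2).
  by exists (- k); rewrite opprK; split=> //; rewrite oppr_ge0.
exists (\sum_ij f ij); first by apply: sumr_ge0 => i _; case: (fP i).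
move=> i j; apply: val_geW (fP (i, j)).2; rewrite lerN2 (bigD1 (i, j))//= lerDl.
by apply: sumr_ge0 => a _; case: (fP a).
Qed.

Lemma mx_ge_exists2 (T : Type) (s : seq T) m n (A : T -> 'M_(m, n)) :
  exists2 N : int, 0 <= N & forall t, List.In t s -> mx_ge (- N) (A t).
Proof.
elim: s => [|t s [N N0 h]]; first by exists 0.
have [M M0 hM] := mx_ge_exists (A t).
exists (N + M); first lia.
by move=> u /= [<-|/h hu]; [apply: mx_geW hM|apply: mx_geW hu]; lia.
Qed.

End LocalField.

(** * Completeness and local compactness *)

Section Compactness.
Variable F : localField.
Local Notation v := (@valuation F).
Local Notation vge := (val_ge v).
Implicit Types x y : F.

(** The ultrametric inequality sums the increments without loss, so the limit is approached at the
    rate of the increments. *)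
Lemma mx_geometric_limit m n (S : int) (u : nat -> 'M[F]_(m, n)) :
  (forall i : nat, mx_ge (S + i%:Z) (u i.+1 - u i)) ->
  exists l, forall i : nat, mx_ge (S + i%:Z) (u i - l).
Proof.
move=> hu.
have hd (a b : nat) : (a <= b)%N -> mx_ge (S + a%:Z) (u b - u a).
  elim: b => [|b IH]; first by rewrite leqn0 => /eqP ->; rewrite subrr; apply: mx_ge0.
  rewrite leq_eqVlt => /orP[/eqP<-|]; first by rewrite subrr; apply: mx_ge0.
  rewrite ltnS => ab; apply: mx_ge_trans (IH ab); apply: mx_geW (hu b); lia.
have cauchy i j : exists l, forall k, exists N, forall a, (N <= a)%N -> vge k (u a i j - l).
  apply: valuation_complete => k.
  exists (absz (k - S)) => a b ha hb.
  have {}hd c : (absz (k - S) <= c)%N -> vge k (u c i j - u (absz (k - S)) i j).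
    by move=> hc; have := hd _ _ hc i j; rewrite !mxE; apply: val_geW; lia.
  by apply: val_ge_trans (hd _ ha) _; apply: val_ge_sym; exact: hd.
have /choice[l lP] : forall ij : 'I_m * 'I_n, exists l, forall k,
    exists N, forall a, (N <= a)%N -> vge k (u a ij.1 ij.2 - l).
  by move=> [i j]; exact: cauchy.
exists (\matrix_(i, j) l (i, j)) => i r c; rewrite !mxE.
have [N hN] := lP (r, c) (S + i%:Z).
have /= h1 := hN _ (leq_maxl N i).
apply: val_ge_trans h1; apply: val_ge_sym.
by have := hd _ _ (leq_maxr N i) r c; rewrite !mxE.
Qed.

Section Cluster.
Context {T : Type} {U : set_system T} (UU : UltraFilter U).

(** The limit is built digit by digit: a ball of radius [k] is covered by finitely many balls of
    radius [k + 1], one for each representative of the residue field, and the ultrafilter selects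
    one of them. Completeness turns the centres into a limit. *)
Lemma ultra_val_ge (f : T -> F) N : U [set t | vge N (f t)] ->
  exists l, forall k, U [set t | vge k (f t - l)].
Proof.
move=> hN.
have step k : (exists a, U [set t | vge k (f t - a)]) ->
    exists a, U [set t | vge (k + 1) (f t - a)].
  move=> [a ha]; have [p p0 vp] := valuation_surj F k.
  have [s sP] := residue_field_finite F.
  have : U [set t | exists2 y, y \in s & vge (k + 1) (f t - (a + p * y))].
    apply: filterS ha => t /= ht.
    have [|y ys hy] := sP (p^-1 * (f t - a)).
      rewrite -(addNr k); apply: val_geM => //; right.
      by rewrite valuationV// vp.
    exists y => //.
    have -> : f t - (a + p * y) = p * (p^-1 * (f t - a) - y).
      by rewrite mulrBr mulVKf// opprD addrA.
    by apply: val_geM => //; right; rewrite vp.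
  elim: {sP} s => [h|y s IH h].
    by have [t [z]] := filter_ex h.
  have [h1|h1] := in_ultra_setVsetC [set t | vge (k + 1) (f t - (a + p * y))] UU.
    by exists (a + p * y).
  apply: IH; apply: filterS2 h h1 => t [z]; rewrite inE => /orP[/eqP->//|zs] hz _.
  by exists z.
have ex (j : nat) : exists a, U [set t | vge (N + j%:Z) (f t - a)].
  elim: j => [|j /step[a ha]].
    by exists 0; rewrite addr0; apply: filterS hN => t; rewrite /= subr0.
  by exists a; apply: filterS ha => t /=; apply: val_geW; lia.
have {}ex (k : int) : exists a, U [set t | vge k (f t - a)].
  have [a ha] := ex (absz (k - N)); exists a; apply: filterS ha => t /=.
  by apply: val_geW; lia.
have /choice[a aP] := fun j : nat => ex j%:Z.
have ad (k : int) (i j : nat) : k <= i%:Z -> k <= j%:Z -> vge k (a i - a j).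
  move=> ki kj; have [t [/= h1 h2]] := filter_ex (filterI (aP i) (aP j)).
  apply: val_ge_trans (val_geW kj h2); apply: val_ge_sym; exact: val_geW h1.
have [l lP] : exists l, forall k, exists N0, forall n, (N0 <= n)%N -> vge k (a n - l).
  apply: valuation_complete => k; exists (absz k) => m n hm hn; apply: ad; lia.
exists l => k; have [N0 hN0] := lP k.
apply: filterS (aP (maxn N0 (absz k))) => t /= ht.
by apply: val_ge_trans (hN0 _ (leq_maxl _ (absz k))); apply: val_geW ht; lia.
Qed.

Lemma ultra_mx_ge m n (f : T -> 'M[F]_(m, n)) N : U [set t | mx_ge N (f t)] ->
  exists l, forall k, U [set t | mx_ge k (f t - l)].
Proof.
move=> hN.
have /choice[l lP] : forall ij : 'I_m * 'I_n, exists l, forall k,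
    U [set t | vge k (f t ij.1 ij.2 - l)].
  by move=> [i j]; apply: (@ultra_val_ge _ N); apply: filterS hN => t; apply.
exists (\matrix_(i, j) l (i, j)) => k.
have hU : U [set t | forall ij, vge k (f t ij.1 ij.2 - l ij)].
  exact: (@filter_forall _ _ _ U _ (fun ij => lP ij k)).
by apply: filterS hU => t /= h i j; rewrite !mxE; exact: (h (i, j)).
Qed.

End Cluster.

Lemma mx_ge_cluster (T : Type) (U : set_system T) m n (f : T -> 'M[F]_(m, n)) N :
  ProperFilter U -> U [set t | mx_ge N (f t)] ->
  exists l, forall k A, U A -> exists2 t, A t & mx_ge k (f t - l).
Proof.
move=> UP hN; have [V [UV sUV]] := ultraFilterLemma UP.
have [l lP] := ultra_mx_ge UV (sUV _ hN).
exists l => k A /sUV VA; have [t [At ht]] := filter_ex (filterI VA (lP k)).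
by exists t.
Qed.

Lemma mx_ge_seq_cluster m n (f : nat -> 'M[F]_(m, n)) N :
  (forall i, mx_ge N (f i)) ->
  exists l, forall k (i : nat), exists2 j, (i <= j)%N & mx_ge k (f j - l).
Proof.
move=> hf; have hU : \oo [set i | mx_ge N (f i)] by apply: filterE => i; exact: hf.
have [l lP] := mx_ge_cluster eventually_filter hU.
exists l => k i.
have [t it ht] := lP k [set j | (i <= j)%N] (nbhs_infty_ge i).
by exists t.
Qed.

End Compactness.

(** * Bounded orbits and the volume cocycle *)

(** A matrix of maximal rank among those with all rows in [P] works: adjoining any further vector of
    [P] cannot raise its rank. *)
Lemma row_space_of_subspace (K : fieldType) n (P : 'rV[K]_n -> Prop) :
  P 0 -> (forall a u w, P u -> P w -> P (a *: u + w)) ->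
  exists A : 'M[K]_n, forall u, P u <-> (u <= A)%MS.
Proof.
move=> P0 PD.
have Psum m (B : 'M[K]_(m, n)) (a : 'rV_m) : (forall i, P (row i B)) -> P (a *m B).
  move=> PB; rewrite mulmx_sum_row; elim/big_ind: _ => //.
    by move=> u w Pu Pw; rewrite -(scale1r u); exact: PD.
  by move=> i _; rewrite -(addr0 (_ *: _)); exact: PD.
pose Q r := `[< exists A : 'M[K]_n, \rank A = r /\ forall i, P (row i A) >].
have exQ : exists r, Q r.
  by exists 0; apply/asboolP; exists 0; rewrite mxrank0; split=> // i; rewrite row0.
have ubQ r : Q r -> (r <= n)%N by move=> /asboolP[A [<- _]]; exact: rank_leq_row.
case: (ex_maxnP exQ ubQ) => r /asboolP[A [rA PA]] max_r.
have subP w : (w <= A)%MS -> P w by move=> /submxP[a ->]; exact: Psum.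
exists A => u; split=> [Pu|]; last exact: subP.
have : Q (\rank (A + u)%MS).
  apply/asboolP; exists (A + u)%MS; split=> // i.
  have /sub_addsmxP[[a c] /= ->] := row_sub i (A + u)%MS.
  rewrite -(scale1r (a *m A)); apply: PD; first exact: Psum.
  by apply: Psum => j; rewrite (_ : row j u = u)//; apply/rowP => k; rewrite mxE ord1.
move=> /max_r; rewrite -rA => hr.
have : (A + u <= A)%MS by rewrite -(geq_leqif (mxrank_leqif_sup (addsmxSl A u))).
by apply: submx_trans; exact: addsmxSr.
Qed.

Section Dynamics.
Variable F : localField.
Local Notation v := (@valuation F).
Local Notation vge := (val_ge v).

(** Matrices act on row vectors from the right. Over an algebraic closure this is the sum of the
    generalised eigenspaces for eigenvalues of absolute value at most 1; Jordan blocks do no harm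
    since binomial coefficients are bounded. *)
Definition bounded_orbit n (x : 'M[F]_n) (u : 'rV[F]_n) :=
  exists N : int, forall k : nat, mx_ge N (u *m x ^+ k).

Lemma bounded_orbitD n (x : 'M[F]_n) a u w :
  bounded_orbit x u -> bounded_orbit x w -> bounded_orbit x (a *: u + w).
Proof.
move=> [N hN] [M hM]; have [c c0 hc] := val_ge_exists a.
exists (Num.min (c + N) M) => k; rewrite mulmxDl -scalemxAl; apply: mx_geD.
  by apply: mx_geW (mx_geZ hc (hN k)); rewrite ge_min lexx.
by apply: mx_geW (hM k); rewrite ge_min lexx orbT.
Qed.

Lemma bounded_orbit0 n (x : 'M[F]_n) : bounded_orbit x 0.
Proof. by exists 0 => k; rewrite mul0mx; exact: mx_ge0. Qed.

Lemma bounded_orbitM n (x : 'M[F]_n) u : bounded_orbit x u <-> bounded_orbit x (u *m x).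
Proof.
split=> [[N hN]|[N hN]].
  by exists N => k; rewrite -mulmxA mulmxE -exprS.
have [M M0 hM] := mx_ge_exists u.
exists (Num.min (- M) N) => -[|k].
  by rewrite expr0 mulmx1; apply: mx_geW hM; rewrite ge_min lexx.
rewrite exprS -mulmxE mulmxA; apply: mx_geW (hN k); by rewrite ge_min lexx orbT.
Qed.

Lemma bounded_orbit_row n (x : 'M[F]_n) m (A : 'M[F]_(m, n)) :
  (forall i, bounded_orbit x (row i A)) ->
  exists2 N : int, 0 <= N & forall k : nat, mx_ge (- N) (A *m x ^+ k).
Proof.
move=> /choice[f fP].
exists (\sum_i `|f i|); first exact: sumr_ge0.
move=> k i j; have := fP i k ord0 j; rewrite -row_mul mxE; apply: val_geW.
have : `|f i| <= \sum_i `|f i| by rewrite (bigD1 i)//= lerDl sumr_ge0.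
move: (\sum_i _) => S; lia.
Qed.

(* [b] identifies the quotient of [F^n] by the vectors with bounded forward
   orbit with [F^d]. *)
Definition unbounded_quotient n d (x : 'M[F]_n) (b : 'M[F]_(n, d)) :=
  (exists s : 'M[F]_(d, n), s *m b = 1%:M) /\
  forall u : 'rV[F]_n, u *m b = 0 <-> bounded_orbit x u.

Lemma unbounded_quotient_exists n (x : 'M[F]_n) :
  exists d (b : 'M[F]_(n, d)), unbounded_quotient x b.
Proof.
have [A hA] := row_space_of_subspace (bounded_orbit0 x) (@bounded_orbitD _ x).
exists _, (col_base (cokermx A)); split.
  exact/row_fullP/col_base_full.
move=> u; rewrite hA submxE.
have -> : u *m cokermx A = u *m col_base (cokermx A) *m row_base (cokermx A).
  by rewrite -mulmxA mulmx_base.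
split=> [->|/eqP h]; first by rewrite mul0mx.
apply: (row_free_inj (row_base_free (cokermx A))).
by rewrite h mul0mx.
Qed.

Lemma unbounded_quotient_uniq n d d' (x : 'M[F]_n) (b : 'M[F]_(n, d)) (b' : 'M[F]_(n, d')) :
  unbounded_quotient x b -> unbounded_quotient x b' ->
  exists2 e : d = d', True & exists2 g : 'M[F]_d', g \in unitmx & b' = castmx (erefl, e) b *m g.
Proof.
move=> [[s sb] hb] [[s' sb'] hb'].
have e1 : b' = b *m (s *m b').
  apply/eqP; rewrite -subr_eq0 mulmxA -{1}(mul1mx b') -mulmxBl; apply/eqP/row_matrixP => i.
  rewrite row0 row_mul; apply/hb'/hb; rewrite -row_mul mulmxBl mul1mx -mulmxA sb mulmx1.
  by rewrite subrr row0.
have e2 : b = b' *m (s' *m b).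
  apply/eqP; rewrite -subr_eq0 mulmxA -{1}(mul1mx b) -mulmxBl; apply/eqP/row_matrixP => i.
  rewrite row0 row_mul; apply/hb/hb'; rewrite -row_mul mulmxBl mul1mx -mulmxA sb' mulmx1.
  by rewrite subrr row0.
have f1 : (s' *m b) *m (s *m b') = 1%:M by rewrite -mulmxA -e1.
have f2 : (s *m b') *m (s' *m b) = 1%:M by rewrite -mulmxA -e2.
have dd : d = d'.
  by apply/eqP; rewrite eqn_leq (mulmx1_min f1) (mulmx1_min f2).
exists dd => //; case: d' / dd b' s' sb' hb' e1 e2 f1 f2 => b' s' sb' hb' e1 e2 f1 f2.
by exists (s *m b'); [case: (mulmx1_unit f1)|rewrite castmx_id].
Qed.

(** The bounded vectors are stable under [x], so [x] acts on the quotient; [s *m x *m b] is the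
    matrix of this action, for any section [s]. *)
Lemma unbounded_quotient_mul n d (x : 'M[F]_n) (b : 'M[F]_(n, d)) s :
  unbounded_quotient x b -> s *m b = 1%:M -> x *m b = b *m (s *m x *m b).
Proof.
move=> [_ hb] sb.
apply/eqP; rewrite -subr_eq0 !mulmxA -mulmxBl -{1}(mul1mx x) -mulmxBl.
apply/eqP/row_matrixP => i; rewrite row0 !row_mul; apply/hb/(bounded_orbitM _ _).1/hb.
by rewrite -row_mul mulmxBl mul1mx -mulmxA sb mulmx1 subrr row0.
Qed.

Lemma mulmx_expr_intertwine n d (x : 'M[F]_n) (b : 'M[F]_(n, d)) y k :
  x *m b = b *m y -> x ^+ k *m b = b *m y ^+ k.
Proof.
move=> h; elim: k => [|k IH]; first by rewrite !expr0 mulmx1 mul1mx.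
by rewrite exprSr -mulmxE -mulmxA h mulmxA IH -mulmxA mulmxE -exprSr.
Qed.

(** The lift [w *m s] would be bounded already under [x]. The defect [t] of the section takes values
    in the bounded vectors, and [w *m s *m x ^+ k] differs from the lift of [w *m y ^+ k] by a sum
    of [k] terms through [t]; these are uniformly bounded, and so is their sum since the valuation
    is ultrametric. *)
Lemma unbounded_quotient_no_bounded n d (x : 'M[F]_n) (b : 'M[F]_(n, d)) s w :
  unbounded_quotient x b -> s *m b = 1%:M ->
  bounded_orbit (s *m x *m b) w -> w = 0.
Proof.
move=> hxb sb; have xb := unbounded_quotient_mul hxb sb; case: hxb => _ hb.
move: xb; set y := s *m x *m b => xb [M hM].
pose t := s *m x - y *m s.
have tb : t *m b = 0 by rewrite mulmxBl -!mulmxA sb mulmx1 mulmxA subrr.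
have [N N0 hN] : exists2 N : int, 0 <= N & forall k : nat, mx_ge (- N) (t *m x ^+ k).
  by apply: bounded_orbit_row => i; apply/hb; rewrite -row_mul tb row0.
have [S S0 hS] := mx_ge_exists s.
suff : bounded_orbit x (w *m s) by move=> /hb; rewrite -mulmxA sb mulmx1.
exists (Num.min (M - S) (M - N)) => k.
have -> : w *m s *m x ^+ k = w *m y ^+ k *m s +
    \sum_(i < k) w *m y ^+ i *m (t *m x ^+ (k - i.+1)).
  elim: k => [|k IH]; first by rewrite !expr0 !mulmx1 big_ord0 addr0.
  rewrite exprSr -mulmxE mulmxA IH mulmxDl big_ord_recr/= subnn expr0 mulmx1.
  rewrite -!mulmxA [in LHS](_ : s *m x = y *m s + t); last by rewrite addrC subrK.
  rewrite !mulmxDr -addrA exprSr -mulmxE -!mulmxA; congr (_ + _).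
  rewrite addrC; congr (_ + _); rewrite mulmx_suml; apply: eq_bigr => i _.
  by rewrite -!mulmxA (_ : (k.+1 - i.+1 = (k - i.+1).+1)%N) ?exprSr// subSS -subSn.
apply: mx_geD.
  by apply: mx_geW (mx_geM (hM k) hS); rewrite ge_min lexx.
apply: mx_ge_sum => i _.
by apply: mx_geW (mx_geM (hM i) (hN _)); rewrite ge_min lexx orbT.
Qed.

Lemma exprVmx_mul d (y : 'M[F]_d) k : y \in unitmx -> invmx y ^+ k *m y ^+ k = 1%:M.
Proof.
move=> yu; elim: k => [|k IH]; first by rewrite !expr0 mulmx1.
by rewrite exprSr exprS -!mulmxE mulmxA -(mulmxA _ (invmx y)) mulVmx// mulmx1.
Qed.

Definition expanding d (y : 'M[F]_d) :=
  y \in unitmx /\ forall j : int, exists m0, forall m, (m0 <= m)%N -> mx_ge j (invmx y ^+ m).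

Lemma mx_ge_cont m n p (A l : 'M[F]_(m, n)) (B : 'M[F]_(n, p)) (j N : int) :
  mx_ge (- N) B -> mx_ge (j + N) (A - l) -> mx_ge j (A *m B - l *m B).
Proof. by move=> hB hA; rewrite -mulmxBl; apply: mx_geW (mx_geM hA hB); lia. Qed.

(* Otherwise a cluster point of counterexamples would have a bounded orbit. *)
Lemma uniform_escape d (y : 'M[F]_d) :
  (forall w, bounded_orbit y w -> w = 0) ->
  exists M : nat, forall p (a : int) (w : 'M[F]_(p, d)),
    (forall k, (k <= M)%N -> mx_ge a (w *m y ^+ k)) -> mx_ge (a + 1) w.
Proof.
move=> hy.
suff [M hM] : exists M : nat, forall w : 'rV[F]_d,
    (forall k, (k <= M)%N -> mx_ge 0 (w *m y ^+ k)) -> mx_ge 1 w.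
  exists M => p a w hw i j.
  have [c c0 vc] := valuation_surj F a.
  have : mx_ge 1 (c^-1 *: row i w).
    apply: hM => k kM; rewrite -scalemxAl -row_mul -(addNr a); apply: mx_geZ.
      by right; rewrite valuationV// vc.
    by move=> i' j'; rewrite mxE; exact: hw.
  move=> /(_ ord0 j); rewrite !mxE => h.
  rewrite -(mulVKf c0 (w i j)); apply: val_geM => //; by right; rewrite vc.
apply: contrapT => /forallNP hM.
have {}hM M : exists w : 'rV[F]_d,
    (forall k, (k <= M)%N -> mx_ge 0 (w *m y ^+ k)) /\ ~ mx_ge 1 w.
  have /existsNP[w /not_implyP[h1 h2]] := hM M; by exists w.
have /choice[w wP] := hM.
have [i|l lP] := @mx_ge_seq_cluster F _ _ w 0.
  by have := (wP i).1 0%N (leq0n _); rewrite expr0 mulmx1.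
have : l = 0.
  apply: hy; exists 0 => k.
  have [N N0 hN] := mx_ge_exists (y ^+ k).
  have [j kj hj] := lP N k.
  rewrite -(subrK (w j *m y ^+ k) (l *m _)); apply: mx_geD; last exact: (wP j).1.
  by apply: mx_ge_sym; apply: mx_ge_cont hN _; rewrite add0r.
move=> l0; have [j _] := lP 1 0%N; rewrite l0 subr0; exact: (wP j).2.
Qed.

(** Read on powers of the inverse, [uniform_escape] says that a bound shared by [M + 1] consecutive
    powers improves by one at the last of them. *)
Lemma expanding_of_no_bounded d (y : 'M[F]_d) :
  (forall w, bounded_orbit y w -> w = 0) -> expanding y.
Proof.
move=> hy; have yu : y \in unitmx.
  rewrite -row_free_unit -kermx_eq0; apply/eqP/row_matrixP => i; rewrite row0.
  apply: hy; apply/bounded_orbitM; rewrite -row_mul mulmx_ker row0; exact: bounded_orbit0.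
split=> //.
have [M hM] := uniform_escape hy.
have [N N0 hN] := mx_ge_exists2 (iota 0 M.+1) (fun i => invmx y ^+ i).
have {}hN i : (i <= M)%N -> mx_ge (- N) (invmx y ^+ i).
  move=> iM; apply: hN; have : i \in iota 0 M.+1 by rewrite mem_iota.
  by elim: (iota _ _) => //= a s IH; rewrite inE => /orP[/eqP->|/IH]; [left|right].
have shift k m : (k <= m)%N -> invmx y ^+ m *m y ^+ k = invmx y ^+ (m - k).
  by move=> km; rewrite -{1}(subnK km) exprD -mulmxE -mulmxA exprVmx_mul// mulmx1.
(* Uniform bound: [t] controls the gap between a provisional bound [a] and [- N]. Each use of [hM]
   closes the gap by one for powers beyond [M]; the others satisfy [- N] by choice of [N]. *)
have low m : mx_ge (- N) (invmx y ^+ m).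
  suff h (t : nat) : forall k, (k <= m)%N -> forall a, - N - a <= t%:Z ->
      (forall k, (k <= m)%N -> mx_ge a (invmx y ^+ k)) -> mx_ge (- N) (invmx y ^+ k).
    have [a a0 ha] := mx_ge_exists2 (iota 0 m.+1) (fun i => invmx y ^+ i).
    apply: (h (absz (a - N)) m (leqnn m) (- a)); first lia.
    move=> k km; apply: ha; have : k \in iota 0 m.+1 by rewrite mem_iota.
    by elim: (iota _ _) => //= b s IH; rewrite inE => /orP[/eqP->|/IH]; [left|right].
  elim: t => [|t IH] k km a hat ha.
    by apply: mx_geW (ha k km); lia.
  have [haN|haN] := leP (- N) a; first by apply: mx_geW (ha k km); lia.
  apply: (IH k km (a + 1)); first lia.
  move=> k' k'm; have [kM|kM] := leqP k' M; first by apply: mx_geW (hN _ kM); lia.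
  apply: hM => i iM; rewrite shift; last by apply: leq_trans (ltnW kM).
  by apply: ha; lia.
(* Every further block of [M] powers gains one unit. *)
have main (j : nat) : forall m, (j * M <= m)%N -> mx_ge (- N + j%:Z) (invmx y ^+ m).
  elim: j => [|j IH] m hm; first by rewrite addr0.
  rewrite intS addrCA addrC; apply: hM => i iM; rewrite shift; last first.
    by apply: leq_trans hm; rewrite mulSn; lia.
  apply: IH; rewrite mulSn in hm; lia.
move=> j; exists (absz (j + N)%R * M)%N => m /main; apply: mx_geW; lia.
Qed.

Lemma unbounded_quotient_expanding n d (x : 'M[F]_n) (b : 'M[F]_(n, d)) s :
  unbounded_quotient x b -> s *m b = 1%:M -> expanding (s *m x *m b).
Proof.
by move=> hb sb; apply: expanding_of_no_bounded => w; exact: unbounded_quotient_no_bounded.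
Qed.

End Dynamics.

(** * Continuity of the unbounded quotient *)

Section Perturbation.
Variable F : localField.
Local Notation v := (@valuation F).
Local Notation vge := (val_ge v).

Lemma mx_ge_near m n (A0 A : 'M[F]_(m, n)) k l :
  k <= l -> mx_ge k A0 -> mx_ge l (A - A0) -> mx_ge k A.
Proof. by move=> kl h0 h; rewrite -(subrK A0 A); apply: mx_geD => //; apply: mx_geW h. Qed.

Lemma mx_ge_exp_near n (x0 : 'M[F]_n) m (k : int) :
  exists k', forall x, mx_ge k' (x - x0) -> mx_ge k (x ^+ m - x0 ^+ m).
Proof.
elim: m k => [|m IH] k; first by exists 0 => x _; rewrite !expr0 subrr; exact: mx_ge0.
have [N N0 hN] := mx_ge_exists x0.
have [M M0 hM] := mx_ge_exists (x0 ^+ m).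
have [k1 hk1] := IH (k + N).
exists (`|k1| + `|k| + M) => x hx.
have -> : x ^+ m.+1 - x0 ^+ m.+1 = (x ^+ m - x0 ^+ m) *m x + x0 ^+ m *m (x - x0).
  by rewrite mulmxBl mulmxBr !mulmxE -!exprSr subrKA.
apply: mx_geD; last by apply: mx_geW (mx_geM hM hx); lia.
have hxN : mx_ge (- N) x by apply: mx_ge_near hN hx; lia.
have hd : mx_ge (k + N) (x ^+ m - x0 ^+ m) by apply: hk1; apply: mx_geW hx; lia.
by apply: mx_geW (mx_geM hd hxN); lia.
Qed.

Lemma bounded_orbit_exp n (x : 'M[F]_n) m u : (0 < m)%N ->
  bounded_orbit x u <-> bounded_orbit (x ^+ m) u.
Proof.
move=> m0; split=> [[N hN]|[N hN]]; first by exists N => k; rewrite -exprM.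
have [M M0 hM] := mx_ge_exists2 (iota 0 m) (fun i => x ^+ i).
exists (N - M) => k; rewrite (divn_eq k m) exprD mulnC exprM -mulmxE mulmxA.
apply: mx_geW (mx_geM (hN _) (hM (k %% m)%N _)) => //.
have : (k %% m)%N \in iota 0 m by rewrite mem_iota ltn_mod m0.
by elim: (iota _ _) => //= a s IH; rewrite inE => /orP[/eqP->|/IH]; [left|right].
Qed.

(* Expanding in words in [A] and [A' - A], each occurrence of the latter
   compensates the loss incurred by one more power of [A]. *)
Lemma power_bounded_near n (A A' : 'M[F]_n) (N : int) :
  (forall k, mx_ge (- N) (A ^+ k)) -> mx_ge N (A' - A) ->
  forall k, mx_ge (- N) (A' ^+ k).
Proof.
move=> hA hAA' k; elim/ltn_ind: k => k IH.
have -> : A' ^+ k = A ^+ k + \sum_(i < k) A ^+ i *m (A' - A) *m A' ^+ (k - i.+1).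
  elim: k {IH} => [|k IH]; first by rewrite !expr0 big_ord0 addr0.
  rewrite exprSr -mulmxE {1}IH mulmxDl big_ord_recr/= subnn expr0 mulmx1.
  rewrite mulmx_suml mulmxBr [in RHS]exprSr -mulmxE [RHS]addrCA [in RHS]addrC.
  rewrite subrKC; congr (_ + _); apply: eq_bigr => i _.
  by rewrite -mulmxA mulmxE -exprSr -subSn.
apply: mx_geD => //; apply: mx_ge_sum => i _.
have hk : mx_ge (- N) (A' ^+ (k - i.+1)) by apply: IH; have := ltn_ord i; lia.
by apply: mx_geW (mx_geM (mx_geM (hA i) hAA') hk); lia.
Qed.

(* The new quotient map is [b0 + phi] with [phi] the fixed point of a
   contraction, namely the graph transform of a large power of [x]. *)
Lemma unbounded_quotient_near n d (x0 : 'M[F]_n) (b0 : 'M[F]_(n, d)) (j : int) :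
  unbounded_quotient x0 b0 ->
  exists k, forall x, mx_ge k (x - x0) ->
    exists2 b : 'M[F]_(n, d), unbounded_quotient x b & mx_ge j (b - b0).
Proof.
move=> hb0; have [[s sb0] kerb0] := hb0.
have xb0 := unbounded_quotient_mul hb0 sb0.
have [xi0u xi0exp] := unbounded_quotient_expanding hb0 sb0.
move: xb0 xi0u xi0exp; set xi0 := s *m x0 *m b0 => xb0 xi0u xi0exp.
(* [e] projects onto the bounded vectors of [x0], the kernel of [b0], along the row space of [s]. *)
have [e eE] : exists e : 'M[F]_n, e = 1%:M - b0 *m s by eexists.
have eb0 : e *m b0 = 0 by rewrite eE mulmxBl mul1mx -mulmxA sb0 mulmx1 subrr.
have se : s *m e = 0 by rewrite eE mulmxBr mulmx1 mulmxA sb0 mul1mx subrr.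
have [N N0 [he hs hb]] : exists2 N : int, 0 <= N &
    [/\ forall k : nat, mx_ge (- N) (e *m x0 ^+ k), mx_ge (- N) s & mx_ge (- N) b0].
  have [N N0 hN] : exists2 N : int, 0 <= N & forall k : nat, mx_ge (- N) (e *m x0 ^+ k).
    by apply: bounded_orbit_row => i; apply/kerb0; rewrite -row_mul eb0 row0.
  have [Ns Ns0 hNs] := mx_ge_exists s; have [Nb Nb0 hNb] := mx_ge_exists b0.
  exists (N + Ns + Nb); first lia.
  by split=> [k||]; [apply: mx_geW (hN k)|apply: mx_geW hNs|apply: mx_geW hNb]; lia.
have he0 : mx_ge (- N) e by have := he 0%N; rewrite expr0 mulmx1.
(* The power [m] is so large that the gain [3 * N + 1] of [zeta], the inverse of the action of [y0]
   on the quotient, outweighs the loss [N] caused by [e] and [e *m y0] and still leaves a unit for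
   the contraction. *)
have [m0 /(_ _ (leqnSn m0))] := xi0exp (3 * N + 1).
move: m0.+1 (ltn0Sn m0) => m m_gt0 {m0 xi0exp} hzeta.
pose xi := xi0 ^+ m; pose zeta := invmx xi0 ^+ m; pose y0 := x0 ^+ m.
have zetaxi : zeta *m xi = 1%:M by exact: exprVmx_mul.
have xizeta : xi *m zeta = 1%:M by exact: mulmx1C.
have yb0 : y0 *m b0 = b0 *m xi by exact: mulmx_expr_intertwine.
have [T T0 hT] := mx_ge_exists y0.
(* [S] is the size required of [phi]: it keeps the new map within [j] of [b0], makes [s *m y *m phi]
   integral and brings [phi *m s *m y] below the threshold [N] of [power_bounded_near]. The margin
   [2 * N] in [k1] pays for the factors of [e *m eta *m b0]. *)
pose S : int := `|j| + 2 * N + T; pose k1 : int := S + 2 * N.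
have [k hk] := mx_ge_exp_near x0 m k1.
exists k => x /hk; set y := x ^+ m; rewrite -/y0; pose eta := y - y0; rewrite -/eta => heta.
have yE : y = y0 + eta by rewrite addrC subrK.
have hy : mx_ge (- T) y by apply: mx_ge_near hT heta; rewrite /k1 /S; lia.
(* The equation to solve is y (b0 + f) = (b0 + f) delta. Its component along [s] determines delta =
   xi + eps, where eps is the inner parenthesis; its component along [e] reads f xi = e (y (b0 + f)
   - f eps), and multiplication by [zeta] isolates f. *)
pose psi (f : 'M_(n, d)) :=
  e *m (y *m (b0 + f) - f *m (s *m eta *m b0 + s *m y *m f)) *m zeta.
have inner f : mx_ge S f -> mx_ge 0 (s *m eta *m b0 + s *m y *m f).
  move=> hf; apply: mx_geD.
    by apply: mx_geW (mx_geM (mx_geM hs heta) hb); rewrite /k1 /S; lia.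
  by apply: mx_geW (mx_geM (mx_geM hs hy) hf); rewrite /S; lia.
have ey f a : mx_ge a f -> mx_ge (a - N) (e *m y *m f).
  move=> hf; rewrite yE mulmxDr mulmxDl; apply: mx_geD.
    by apply: mx_geW (mx_geM (he m) hf); lia.
  by apply: mx_geW (mx_geM (mx_geM he0 heta) hf); rewrite /k1 /S; lia.
have psiS f : mx_ge S f -> mx_ge S (psi f).
  move=> hf; apply: (@mx_geW _ _ _ _ (S - N + (3 * N + 1))); first lia.
  apply: mx_geM hzeta; rewrite mulmxBr (mulmxDr y) (mulmxDr e); apply: mx_geB; last first.
    by apply: mx_geW (mx_geM he0 (mx_geM hf (inner f hf))); lia.
  apply: mx_geD; last by rewrite mulmxA; exact: ey.
  rewrite yE mulmxDl (mulmxDr e) yb0 (mulmxA e b0) eb0 mul0mx add0r.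
  by apply: mx_geW (mx_geM he0 (mx_geM heta hb)); rewrite /k1; lia.
have psi_contract f g a : mx_ge S f -> mx_ge S g -> mx_ge a (f - g) ->
    mx_ge (a + 1) (psi f - psi g).
  move=> hf hg hfg; rewrite /psi -mulmxBl -mulmxBr.
  have -> : y *m (b0 + f) - f *m (s *m eta *m b0 + s *m y *m f) -
      (y *m (b0 + g) - g *m (s *m eta *m b0 + s *m y *m g)) =
      y *m (f - g) - ((f - g) *m (s *m eta *m b0 + s *m y *m f)
                      + g *m (s *m y *m (f - g))).
    set A := s *m eta *m b0; set B := s *m y.
    have h1 : y *m (f - g) = y *m (b0 + f) - y *m (b0 + g).
      by rewrite -mulmxBr opprD addrACA subrr add0r.
    have h2 : B *m (f - g) = (A + B *m f) - (A + B *m g).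
      by rewrite mulmxBr opprD addrACA subrr add0r.
    by rewrite h1 h2 mulmxBl mulmxBr subrKA opprD [LHS]addrACA -opprD.
  apply: (@mx_geW _ _ _ _ (a - N + (3 * N + 1))); first lia.
  apply: mx_geM hzeta; rewrite mulmxBr (mulmxDr e); apply: mx_geB.
    by rewrite mulmxA; exact: ey.
  apply: mx_geD; first by apply: mx_geW (mx_geM he0 (mx_geM hfg (inner f hf))); lia.
  apply: mx_geW (mx_geM he0 (mx_geM hg (mx_geM (mx_geM hs hy) hfg))); rewrite /S; lia.
pose u i := iter i psi 0.
have uS i : mx_ge S (u i) by elim: i => [|i IH]; [exact: mx_ge0|exact: psiS].
have ustep (i : nat) : mx_ge (S + i%:Z) (u i.+1 - u i).
  elim: i => [|i IH]; first by rewrite addr0 subr0; exact: uS.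
  by apply: mx_geW (psi_contract _ _ _ (uS _) (uS _) IH); lia.
have [phi hphi] := mx_geometric_limit ustep.
have phiS : mx_ge S phi.
  by have := hphi 0%N; rewrite addr0 sub0r => /mx_geN.
have phi_fix : psi phi = phi.
  apply/eqP; rewrite -subr_eq0; apply/eqP/mx_ge_eq0 => a.
  apply: (@mx_geW _ _ _ _ (S + (absz (a - S))%:Z)); first lia.
  set i := absz (a - S); apply: (@mx_ge_trans _ _ _ _ _ (u i.+1)).
    apply: mx_geW (psi_contract _ _ _ phiS (uS i) (mx_ge_sym (hphi i))); lia.
  by apply: mx_geW (hphi i.+1); lia.
have sphi : s *m phi = 0 by rewrite -phi_fix /psi !mulmxA se !mul0mx.
have ephi : e *m phi = phi by rewrite eE mulmxBl mul1mx -mulmxA sphi mulmx0 subr0.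
pose b := b0 + phi.
have sb : s *m b = 1%:M by rewrite mulmxDr sb0 sphi addr0.
pose eps := s *m eta *m b0 + s *m y *m phi; pose delta := xi + eps.
have heps : mx_ge 0 eps by exact: inner.
have syb : s *m (y *m b) = delta.
  have h : s *m y *m b0 = xi + s *m eta *m b0.
    by rewrite {1}yE mulmxDr mulmxDl -mulmxA yb0 mulmxA sb0 mul1mx.
  by rewrite mulmxA /b mulmxDr h -addrA.
have eyb : e *m (y *m b) = phi *m delta.
  have : phi *m xi = e *m (y *m b - phi *m eps).
    by rewrite -[in LHS]phi_fix /psi -mulmxA zetaxi mulmx1.
  by rewrite mulmxBr (mulmxA e phi) ephi => h; rewrite /delta (mulmxDr phi) h subrK.
have yb : y *m b = b *m delta.
  rewrite -[LHS]mul1mx -(subrK (b0 *m s) 1%:M) -eE mulmxDl eyb -mulmxA syb.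
  by rewrite addrC mulmxDl.
exists b; last by rewrite addrC addKr; apply: mx_geW phiS; rewrite /S; lia.
split; first by exists s.
move=> w; split=> [wb|/(bounded_orbit_exp _ _ m_gt0)[a ha]]; last first.
  apply: mx_ge_eq0.
  have hw k' : mx_ge (a - N - `|S|) (w *m b *m delta ^+ k').
    rewrite -mulmxA -(mulmx_expr_intertwine _ yb) mulmxA.
    have hbb : mx_ge (- N - `|S|) b by apply: mx_geD; [apply: mx_geW hb|apply: mx_geW phiS]; lia.
    by apply: mx_geW (mx_geM (ha k') hbb); lia.
  (* Since [delta - eps] is [xi], which [zeta] inverts, the vector at [k'] is recovered from those
     at [k'] and [k'.+1] with a gain. Iterating for all [k'] at once makes [w *m b] arbitrarily
     small, hence zero. *)
  have hw' (i : nat) : forall k', mx_ge (a - N - `|S| + i%:Z) (w *m b *m delta ^+ k').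
    elim: i => [|i IH] k'; first by rewrite addr0; exact: hw.
    have -> : w *m b *m delta ^+ k' = (w *m b *m delta ^+ k'.+1
        - w *m b *m delta ^+ k' *m eps) *m zeta.
      rewrite exprSr -mulmxE mulmxA -mulmxBr (_ : delta - eps = xi); last by rewrite addrK.
      by rewrite -(mulmxA _ xi) xizeta mulmx1.
    have h1 := mx_geM (IH k') heps; rewrite addr0 in h1.
    by apply: mx_geW (mx_geM (mx_geB (IH k'.+1) h1) hzeta); lia.
  move=> c; have := hw' (absz (c - (a - N - `|S|))%R) 0%N.
  by rewrite expr0 mulmx1; apply: mx_geW; lia.
apply/(bounded_orbit_exp _ _ m_gt0).
(* [e'] projects onto the kernel of [b], where [y] and [e' *m y] have the same orbits. The matrix
   [e' *m y] is close to [e *m y0], whose powers are bounded because they are [e *m x0 ^+ (m * k')]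
   for positive [k']. *)
have [e' e'E] : exists e' : 'M[F]_n, e' = 1%:M - b *m s by eexists.
have we' (r : 'rV_n) : r *m b = 0 -> r *m e' = r.
  by move=> h; rewrite e'E mulmxBr mulmx1 mulmxA h mul0mx subr0.
have wA' k' : w *m y ^+ k' = w *m (e' *m y) ^+ k'.
  elim: k' => [|k' IH]; first by rewrite !expr0.
  rewrite !exprSr -!mulmxE !mulmxA -IH we'// -mulmxA.
  by rewrite (mulmx_expr_intertwine _ yb) mulmxA wb mul0mx.
have hA k' : mx_ge (- N) ((e *m y0) ^+ k').
  have -> : (e *m y0) ^+ k' = if k' is 0 then 1 else e *m x0 ^+ (m * k').
    elim: k' => [|[|k'] IH]; rewrite ?expr0//; first by rewrite expr1 muln1.
    rewrite exprSr IH -mulmxE mulmxA; set X := x0 ^+ _.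
    have -> : e *m X *m e = e *m X.
      rewrite {2}eE mulmxBr mulmx1 mulmxA -(mulmxA e X).
      by rewrite (mulmx_expr_intertwine _ xb0) (mulmxA e) eb0 !mul0mx subr0.
    by rewrite -mulmxA (mulnS m) addnC exprD -mulmxE.
  case: k' => [|k']; last exact: he.
  by apply: mx_geW (@mx_ge1 F n); lia.
have hAA' : mx_ge N (e' *m y - e *m y0).
  have -> : e' *m y - e *m y0 = e *m eta - phi *m s *m y.
    have -> : e' = e - phi *m s by rewrite e'E eE /b mulmxDl opprD addrA.
    by rewrite mulmxBl mulmxBr addrAC.
  apply: mx_geB; first by apply: mx_geW (mx_geM he0 heta); rewrite /k1 /S; lia.
  by apply: mx_geW (mx_geM (mx_geM phiS hs) hy); rewrite /S; lia.
have [c c0 hc] := mx_ge_exists w.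
exists (- c - N) => k'; rewrite wA'.
by apply: mx_geM hc _; exact: power_bounded_near hA hAA' k'.
Qed.

End Perturbation.

(** * Minors, lattice volumes and the cocycle *)

Section Determinants.
Variable F : localField.
Local Notation v := (@valuation F).
Local Notation vge := (val_ge v).

Lemma valuation_near (a0 a : F) : a0 != 0 -> vge (v a0 + 1) (a - a0) ->
  a != 0 /\ v a = v a0.
Proof.
move=> a00 h.
have h1 : ~ vge (v a0 + 1) a0 by move/(val_geE _ a00); lia.
have a1 : ~ vge (v a0 + 1) a.
  by move=> ha; apply: h1; have := val_geB ha h; rewrite subKr.
have a2 : a != 0 by apply/eqP => a0'; apply: a1; rewrite a0'; left.
split=> //; apply: le_anti; apply/andP; split.
  by rewrite -ltzD1 ltNge; apply/negP => /(val_geE _ a2).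
apply/(val_geE _ a2); rewrite -(subrK a0 a); apply: val_geD; last by right.
by apply: val_geW h; lia.
Qed.

Lemma prod_near (J : Type) (r : seq J) (a0 : J -> F) k :
  exists k', forall a, (forall i, vge k' (a i - a0 i)) ->
    vge k (\prod_(i <- r) a i - \prod_(i <- r) a0 i).
Proof.
elim: r k => [|j r IH] k; first by exists 0 => a _; rewrite !big_nil subrr; left.
have [N N0 hN] := val_ge_exists (a0 j).
have [M M0 hM] := val_ge_exists (\prod_(i <- r) a0 i).
have [k1 hk1] := IH (k - N).
exists (`|k1| + `|k| - M) => a ha; rewrite !big_cons.
have -> (c d e f : F) : c * d - e * f = c * (d - f) + (c - e) * f by ring.
apply: val_geD; last by apply: val_geW (val_geM (ha j) hM); lia.
have hj : vge N (a j).
  by rewrite -(subrK (a0 j) (a j)); apply: val_geD => //; apply: val_geW (ha j); lia.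
have hr : vge (k - N) (\prod_(i <- r) a i - \prod_(i <- r) a0 i).
  by apply: hk1 => i; apply: val_geW (ha i); lia.
by apply: val_geW (val_geM hj hr); lia.
Qed.

Lemma finite_int_bound (J : finType) (f : J -> int) : exists M, forall i, f i <= M.
Proof.
exists (\sum_i `|f i|) => i.
have : `|f i| <= \sum_i `|f i| by rewrite (bigD1 i)//= lerDl sumr_ge0.
by move: (\sum_i _) => S; lia.
Qed.

Lemma det_near n (A0 : 'M[F]_n) k :
  exists k', forall A, mx_ge k' (A - A0) -> vge k (\det A - \det A0).
Proof.
have /choice[f fP] (s : {perm 'I_n}) := prod_near (index_enum 'I_n) (fun i => A0 i (s i)) k.
have [M hM] := finite_int_bound f.
exists M => A hA; rewrite /determinant -sumrB; apply: val_ge_sum => s _.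
rewrite -mulrBr -[k]add0r; apply: val_geM.
  by right; case: (s : bool); rewrite ?expr1 ?expr0 ?valuationN valuation1.
by apply: fP => i; have := hA i (s i); rewrite !mxE; apply: val_geW.
Qed.

Lemma det_mx_ge0 n (A : 'M[F]_n) : mx_ge 0 A -> vge 0 (\det A).
Proof.
move=> hA; rewrite /determinant; apply: val_ge_sum => s _.
rewrite -[0]add0r; apply: val_geM.
  by right; case: (s : bool); rewrite ?expr1 ?expr0 ?valuationN valuation1.
elim/big_ind: _ => //; first exact: val_ge1.
by move=> a b ha hb; rewrite -[0]add0r; apply: val_geM.
Qed.

Lemma det_mx_ge1 n (A : 'M[F]_n) : (0 < n)%N -> mx_ge 1 A -> vge 1 (\det A).
Proof.
move=> n0 hA; have [p p0 vp] := valuation_surj F 1.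
have -> : A = p *: (p^-1 *: A) by rewrite scalerA mulfV// scale1r.
rewrite detZ; apply: (@val_geW _ _ (v (p ^+ n) + 0)).
  by rewrite valuationX// vp addr0 natz; lia.
apply: val_geM; first by right.
apply: det_mx_ge0; rewrite -(addNr 1); apply: mx_geZ => //.
by right; rewrite valuationV// vp.
Qed.

(** The relations K = - K E for the kernel and Y = 1 - E Y for the inverse each improve a given
    bound by one; for the kernel without end, for the inverse until the summand 1 caps it at 0. *)
Lemma invmx_add1 n (E : 'M[F]_n) : mx_ge 1 E ->
  1%:M + E \in unitmx /\ mx_ge 0 (invmx (1%:M + E)).
Proof.
move=> hE; have Eu : 1%:M + E \in unitmx.
  rewrite -row_free_unit -kermx_eq0; set K := kermx _; apply/eqP.
  have hK : K = - (K *m E).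
    by apply/eqP; rewrite -addr_eq0 -{1}(mulmx1 K) -mulmxDr mulmx_ker.
  have [M M0 hM] := mx_ge_exists K.
  have hi (i : nat) : mx_ge (- M + i%:Z) K.
    elim: i => [|i IH]; first by rewrite addr0.
    by rewrite hK; apply/mx_geN; apply: mx_geW (mx_geM IH hE); lia.
  by apply: mx_ge_eq0 => k; apply: mx_geW (hi (absz (k + M)%R)); lia.
split=> //.
have [Y YE] : exists Y : 'M[F]_n, Y = invmx (1%:M + E) by eexists.
have hY : Y = 1%:M - E *m Y.
  by apply/eqP; rewrite eq_sym subr_eq -[X in X + _](mul1mx Y) -mulmxDl YE mulmxV.
rewrite -YE; have [M M0 hM] := mx_ge_exists Y.
suff hi (i : nat) : mx_ge (Num.min 0 (- M + i%:Z)) Y.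
  by apply: mx_geW (hi (absz M)); lia.
elim: i => [|i IH]; first by apply: mx_geW hM; lia.
rewrite hY; apply: mx_geB; first by apply: mx_geW (@mx_ge1 F n); lia.
by apply: mx_geW (mx_geM hE IH); lia.
Qed.

Lemma invmx_mul n (A B : 'M[F]_n) : A \in unitmx -> B \in unitmx ->
  invmx (A *m B) = invmx B *m invmx A.
Proof.
move=> Au Bu; have ABu : A *m B \in unitmx by rewrite unitmx_mul Au.
by apply: (can_inj (mulKmx ABu)); rewrite mulmxV// -mulmxA mulKVmx// mulmxV.
Qed.

Lemma invmx_near_bound n (h0 h : 'M[F]_n) (N : int) :
  h0 \in unitmx -> 0 <= N -> mx_ge (- N) (invmx h0) -> mx_ge (1 + N) (h - h0) ->
  h \in unitmx /\ mx_ge (- N) (invmx h).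
Proof.
move=> h0u N0 hN hh.
have hE : mx_ge 1 (invmx h0 *m (h - h0)) by apply: mx_geW (mx_geM hN hh); lia.
have hE1 : h = h0 *m (1%:M + invmx h0 *m (h - h0)).
  by rewrite mulmxDr mulmx1 mulmxA mulmxV// mul1mx subrKC.
have [Eu hY] := invmx_add1 hE.
have hu : h \in unitmx by rewrite hE1 unitmx_mul h0u.
by split=> //; rewrite hE1 invmx_mul//; apply: mx_geW (mx_geM hY hN); lia.
Qed.

Lemma invmx_near n (h0 : 'M[F]_n) j : h0 \in unitmx ->
  exists k, forall h, mx_ge k (h - h0) -> h \in unitmx /\ mx_ge j (invmx h - invmx h0).
Proof.
move=> h0u; have [N N0 hN] := mx_ge_exists (invmx h0).
exists (1 + N + N + `|j|) => h hh.
have [|hu hhN] := invmx_near_bound h0u N0 hN (_ : mx_ge (1 + N) (h - h0)).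
  by apply: mx_geW hh; lia.
split=> //.
have -> : invmx h - invmx h0 = - (invmx h *m (h - h0) *m invmx h0).
  rewrite mulmxBr mulVmx// mulmxBl mul1mx -mulmxA mulmxV// mulmx1 opprB.
  by [].
by apply/mx_geN; apply: mx_geW (mx_geM (mx_geM hhN hh) hN); lia.
Qed.

(** This [k] is the valuation of the ideal generated by the maximal minors of [b], hence the
    logarithmic covolume of the lattice spanned by the rows of [b] in [F^d]. Non-injective [f] are
    harmless: a repeated row gives the minor 0. *)
Definition min_minor n d (b : 'M[F]_(n, d)) k :=
  (forall f : {ffun 'I_d -> 'I_n}, vge k (\det (rowsub f b))) /\
  exists f : {ffun 'I_d -> 'I_n}, \det (rowsub f b) != 0 /\ v (\det (rowsub f b)) = k.

Lemma min_minor_uniq n d (b : 'M_(n, d)) k l : min_minor b k -> min_minor b l -> k = l.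
Proof.
move=> [hk [f [f0 fk]]] [hl [g [g0 gl]]]; apply: le_anti; apply/andP; split.
  by rewrite -gl; apply/val_geE.
by rewrite -fk; apply/val_geE.
Qed.

Lemma min_minor_exists n d (b : 'M_(n, d)) s : s *m b = 1%:M -> exists k, min_minor b k.
Proof.
move=> sb; have bf : row_full b by apply/row_fullP; exists s.
pose P (f : {ffun 'I_d -> 'I_n}) := \det (rowsub f b) != 0.
have Pf : P (fullrankfun bf).
  by have := fullrowsub_unit bf; rewrite unitmxE unitfE.
case: (arg_minP (fun f : {ffun 'I_d -> 'I_n} => v (\det (rowsub f b))) Pf) => f f0 fmin.
exists (v (\det (rowsub f b))); split; last by exists f.
move=> g; have [->|g0] := eqVneq (\det (rowsub g b)) 0; first by left.
by right; exact: fmin.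
Qed.

Definition minor_val n d (b : 'M_(n, d)) : int := xget 0 (min_minor b).

Lemma minor_valE n d (b : 'M_(n, d)) k : min_minor b k -> minor_val b = k.
Proof.
by move=> hk; exact: min_minor_uniq (xgetPex 0 (ex_intro _ k hk)) hk.
Qed.

Lemma min_minorP n d (b : 'M_(n, d)) s : s *m b = 1%:M -> min_minor b (minor_val b).
Proof. by move=> /min_minor_exists[k hk]; rewrite (minor_valE hk). Qed.

Lemma minor_val_mulr n d (b : 'M_(n, d)) s g : s *m b = 1%:M -> g \in unitmx ->
  minor_val (b *m g) = minor_val b + v (\det g).
Proof.
move=> /min_minorP[hk [f [f0 fk]]] gu; have g0 : \det g != 0 by rewrite -unitfE -unitmxE.
apply: minor_valE; split=> [f'|].
  by rewrite -mul_rowsub_mx det_mulmx; apply: val_geM => //; right.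
by exists f; rewrite -mul_rowsub_mx det_mulmx mulf_neq0// valuationM// fk.
Qed.

(** Moving all minors by less than the smallest one in absolute value leaves the valuation of that
    one unchanged and lets no other drop below it. *)
Lemma minor_val_near n d (b0 : 'M_(n, d)) s : s *m b0 = 1%:M ->
  exists k, forall b, mx_ge k (b - b0) -> minor_val b = minor_val b0.
Proof.
move=> /min_minorP; set m := minor_val b0 => -[hk [f [f0 fk]]].
have /choice[g gP] (f' : {ffun 'I_d -> 'I_n}) := det_near (rowsub f' b0) (m + 1).
have [M hM] := finite_int_bound g.
exists M => b hb.
have near (f' : {ffun 'I_d -> 'I_n}) : vge (m + 1) (\det (rowsub f' b) - \det (rowsub f' b0)).
  apply: gP => i j; rewrite !mxE; apply: val_geW (hM f') _.
  by have := hb (f' i) j; rewrite !mxE.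
apply: minor_valE; split=> [f'|].
  rewrite -(subrK (\det (rowsub f' b0)) (\det _)); apply: val_geD => //.
  by apply: val_geW (near f'); lia.
by exists f; have := near f; rewrite -fk => /(valuation_near f0).
Qed.

Definition qmap_sig n (x : 'M[F]_n) := cid (unbounded_quotient_exists x).
Definition qmap n (x : 'M[F]_n) := projT1 (cid (projT2 (qmap_sig x))).

Lemma qmapP n (x : 'M[F]_n) : unbounded_quotient x (qmap x).
Proof. exact: projT2 (cid (projT2 (qmap_sig x))). Qed.

(* The logarithm of the factor by which [h] scales the volume of the quotient
   of [F^n] by the vectors with bounded [x]-orbit, volumes being normalised by
   the image of the standard lattice; [v (det g)] cancels on changing [qmap x]
   to [qmap x *m g]. *)
Definition volume_cocycle n (x h : 'M[F]_n) : int :=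
  minor_val (invmx h *m qmap x) - minor_val (qmap x).

Lemma left_inverse_mul n d (b : 'M[F]_(n, d)) s h : h \in unitmx -> s *m b = 1%:M ->
  (s *m h) *m (invmx h *m b) = 1%:M.
Proof. by move=> hu sb; rewrite mulmxA -(mulmxA s) mulmxV// mulmx1. Qed.

Lemma volume_cocycleE n d (x h : 'M[F]_n) (b : 'M[F]_(n, d)) : h \in unitmx ->
  unbounded_quotient x b -> volume_cocycle x h = minor_val (invmx h *m b) - minor_val b.
Proof.
move=> hu hb; have [e _ [g gu ->]] := unbounded_quotient_uniq (qmapP x) hb.
rewrite /volume_cocycle; move: (qmapP x); move: (qmap x) => q [[s sq] _].
case: _ / e g gu {hb b} => g gu; rewrite castmx_id mulmxA.
rewrite (minor_val_mulr sq gu) (minor_val_mulr (left_inverse_mul hu sq) gu).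
by rewrite opprD addrACA subrr addr0.
Qed.

Lemma unbounded_quotient_conj n d (x h : 'M[F]_n) (b : 'M[F]_(n, d)) : h \in unitmx ->
  unbounded_quotient x b -> unbounded_quotient (invmx h *m x *m h) (invmx h *m b).
Proof.
move=> hu [[s sb] kb]; split; first by exists (s *m h); exact: left_inverse_mul.
have hX k : (invmx h *m x *m h) ^+ k = invmx h *m x ^+ k *m h.
  elim: k => [|k IH]; first by rewrite !expr0 mulmx1 mulVmx.
  by rewrite !exprSr IH -!mulmxE !mulmxA mulmxK.
have [N N0 hN] := mx_ge_exists h; have [M M0 hM] := mx_ge_exists (invmx h).
move=> u; rewrite mulmxA kb; split=> [[a ha]|[a ha]].
  by exists (a - N) => k; rewrite hX !mulmxA; apply: mx_geM => //.
exists (a - M) => k; have := mx_geM (ha k) hM.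
by rewrite hX -!mulmxA mulmxV// mulmx1 !mulmxA.
Qed.

Lemma volume_cocycleM n (x h h' : 'M[F]_n) : h \in unitmx -> h' \in unitmx ->
  volume_cocycle x (h *m h') =
  volume_cocycle x h + volume_cocycle (invmx h *m x *m h) h'.
Proof.
move=> hu h'u.
rewrite (volume_cocycleE h'u (unbounded_quotient_conj hu (qmapP x))).
by rewrite /volume_cocycle invmx_mul// -mulmxA [RHS]addrC subrKA.
Qed.

Lemma volume_cocycle_exp n (x h : 'M[F]_n) m : (0 < m)%N -> h \in unitmx ->
  volume_cocycle (x ^+ m) h = volume_cocycle x h.
Proof.
move=> m0 hu; rewrite (@volume_cocycleE _ _ _ _ (qmap x))//.
by have [hs hk] := qmapP x; split=> // u; rewrite hk (bounded_orbit_exp _ _ m0).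
Qed.

Lemma unitmx_exp n (x : 'M[F]_n) m : x \in unitmx -> x ^+ m \in unitmx.
Proof.
move=> xu; elim: m => [|m IH]; first by rewrite expr0 unitmx1.
by rewrite exprS -mulmxE unitmx_mul xu.
Qed.

Lemma volume_cocycle_self_exp n (x : 'M[F]_n) m : (0 < m)%N -> x \in unitmx ->
  volume_cocycle (x ^+ m) (x ^+ m) = volume_cocycle x x *+ m.
Proof.
move=> m0 xu; rewrite volume_cocycle_exp ?unitmx_exp//.
case: m m0 => // m _; elim: m => [|m IH]; first by rewrite expr1.
by rewrite exprS -mulmxE volume_cocycleM ?unitmx_exp// mulVmx// mul1mx IH [RHS]mulrS.
Qed.

(** The chosen maps [qmap x] and [qmap x0] need not be close to each other, so the cocycle at [x] is
    computed by [volume_cocycleE] from a quotient map near [qmap x0]. *)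
Lemma volume_cocycle_near n (x0 h0 : 'M[F]_n) : h0 \in unitmx ->
  exists k, forall x h, mx_ge k (x - x0) -> mx_ge k (h - h0) ->
    volume_cocycle x h = volume_cocycle x0 h0.
Proof.
move=> h0u; have hq := qmapP x0; have [[s sq] _] := hq.
have [k1 hk1] := minor_val_near sq.
have [k2 hk2] := minor_val_near (left_inverse_mul h0u sq).
have [N N0 hN] := mx_ge_exists (qmap x0).
have [M M0 hM] := mx_ge_exists (invmx h0).
have [k3 hk3] := invmx_near (`|k2| + N) h0u.
have [k4 hk4] := unbounded_quotient_near (`|k1| + `|k2| + M) hq.
exists (`|k3| + `|k4|) => x h hx hh.
have [|hu hhinv] := hk3 h; first by apply: mx_geW hh; lia.
have [|b hb hbq] := hk4 x; first by apply: mx_geW hx; lia.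
rewrite (volume_cocycleE hu hb) /volume_cocycle; congr (_ - _); last first.
  by apply: hk1; apply: mx_geW hbq; lia.
apply: hk2; apply: (@mx_ge_trans _ _ _ _ _ (invmx h *m qmap x0)).
  rewrite -mulmxBr; have hhM : mx_ge (- M) (invmx h) by apply: mx_ge_near hM hhinv; lia.
  by apply: mx_geW (mx_geM hhM hbq); lia.
by rewrite -mulmxBl; apply: mx_geW (mx_geM hhinv hN); lia.
Qed.

(** The value at (x, x) is - v(det y), with y the action of [x] on the quotient. As the powers of
    the inverse of y tend to 0, it can vanish only if the quotient has dimension 0. *)
Lemma volume_cocycle_eq0 n (x : 'M[F]_n) : x \in unitmx -> volume_cocycle x x = 0 ->
  forall u, bounded_orbit x u.
Proof.
move=> xu; have hq := qmapP x; have [[s sq] hk] := hq.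
have xq := unbounded_quotient_mul hq sq.
have [yu yexp] := unbounded_quotient_expanding hq sq.
move: xq yu yexp; set y := s *m x *m qmap x => xq yu yexp h0 u.
apply/hk; suff d0 : projT1 (qmap_sig x) = 0%N.
  have thin d (q : 'M[F]_(n, d)) : d = 0%N -> u *m q = 0.
    by case: d q => // q _; rewrite [LHS]thinmx0.
  exact: thin.
apply/eqP; rewrite -leqn0 leqNgt; apply/negP => d_gt0.
have iyu : invmx y \in unitmx by rewrite unitmx_inv.
have vy : v (\det (invmx y)) = 0.
  move: h0; rewrite /volume_cocycle.
  have -> : invmx x *m qmap x = qmap x *m invmx y.
    apply: (can_inj (mulKmx xu)); rewrite mulKVmx// mulmxA xq -mulmxA mulmxV//.
    by rewrite mulmx1.
  by rewrite (minor_val_mulr sq iyu) addrC addKr.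
have [m0 /(_ m0.+1 (leqnSn _))] := yexp 1.
move=> /(det_mx_ge1 d_gt0) h.
have dX k : \det (invmx y ^+ k) = \det (invmx y) ^+ k.
  elim: k => [|k IH]; first by rewrite !expr0 det1.
  by rewrite !exprS -mulmxE det_mulmx IH.
move: h; rewrite dX => /(@val_geE F).
have d0 : \det (invmx y) != 0 by rewrite -unitfE -unitmxE.
by move=> /(_ (expf_neq0 _ d0)); rewrite valuationX// vy mul0rn.
Qed.

End Determinants.

(** * Groups of rational points *)

Section RationalPointsTopology.
Variables (F : localField) (Fbar : fieldType) (phi : {rmorphism F -> Fbar}).
Variable GG : connectedReductiveGroup phi.
Local Notation v := (@valuation F).
Local Notation vge := (val_ge v).
Local Notation G := (rational_points GG).
Local Notation n := (crg_dim GG).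
Implicit Types g h : G.

Lemma rp_mxM g h : rp_mx (g * h)%g = rp_mx g *m rp_mx h.
Proof. by []. Qed.

Lemma rp_mxV g : rp_mx g^-1%g = invmx (rp_mx g).
Proof. by []. Qed.

Lemma rp_mxX g k : rp_mx (g ^+ k)%g = rp_mx g ^+ k.
Proof.
elim: k => [|k IH]; first by rewrite expg0 expr0.
by rewrite expgS exprS -mulmxE -IH.
Qed.

Lemma nbhs_rationalP g (A : set G) :
  nbhs g A <-> exists k, forall h, mx_ge k (rp_mx h - rp_mx g) -> A h.
Proof.
have mxgeE k h g' : mx_ge k (rp_mx h - rp_mx g') <->
    forall i j, vge k (h i j - g' i j).
  by split=> H i j; have := H i j; rewrite !mxE.
split=> [|[k hk]].
  rewrite nbhsE => -[B [oB Bg] BA].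
  by have [k hk] := oB g Bg; exists k => h /mxgeE /hk /BA.
exists [set h : G | mx_ge k (rp_mx h - rp_mx g)]; split=> //; last first.
  by rewrite /= subrr; exact: mx_ge0.
move=> h /= hh; exists k => h' /mxgeE hh'; exact: mx_ge_trans hh' hh.
Qed.

Lemma rational_mul_continuous : continuous (fun p : G * G => (p.1 * p.2)%g).
Proof.
move=> [g h] A /nbhs_rationalP[k hk]; rewrite /nbhs/=.
have [N N0 hN] := mx_ge_exists (rp_mx g); have [M M0 hM] := mx_ge_exists (rp_mx h).
exists ([set g' : G | mx_ge (`|k| + M) (rp_mx g' - rp_mx g)],
        [set h' : G | mx_ge (`|k| + N) (rp_mx h' - rp_mx h)]).
  by split; apply/nbhs_rationalP; [exists (`|k| + M)|exists (`|k| + N)].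
move=> [g' h'] [/= hg hh]; apply: hk => /=.
have -> : rp_mx g' *m rp_mx h' - rp_mx g *m rp_mx h =
    (rp_mx g' - rp_mx g) *m rp_mx h' + rp_mx g *m (rp_mx h' - rp_mx h).
  by rewrite mulmxBl mulmxBr subrKA.
have hM' : mx_ge (- M) (rp_mx h') by apply: mx_ge_near hM hh; lia.
apply: mx_geD; first by apply: mx_geW (mx_geM hg hM'); lia.
by apply: mx_geW (mx_geM hN hh); lia.
Qed.

Lemma rational_inv_continuous : continuous (fun g : G => g^-1%g).
Proof.
move=> g A /nbhs_rationalP[k hk]; apply/nbhs_rationalP.
have [k' hk'] := invmx_near k (rational_unit g).
by exists k' => h /hk'[_ hh]; apply: hk.
Qed.

Definition congruence_set (k : int) : set G := [set g | mx_ge k (rp_mx g - 1%:M)].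

Lemma congruence_subgroup k : 1 <= k -> is_subgroup (congruence_set k).
Proof.
move=> k1; rewrite /congruence_set; have hge0 (A : 'M[F]_n) : mx_ge k (A - 1%:M) -> mx_ge 0 A.
  by move=> h; apply: mx_ge_near (@mx_ge1 F n) h; lia.
split=> /= [|g h hg hh|g hg]; first by rewrite subrr; exact: mx_ge0.
- have -> : rp_mx g *m rp_mx h - 1%:M = (rp_mx g - 1%:M) *m rp_mx h + (rp_mx h - 1%:M).
    by rewrite mulmxBl mul1mx subrKA.
  by apply: mx_geD => //; rewrite -[k]addr0; apply: mx_geM => //; exact: hge0.
- have [_] := invmx_add1 (mx_geW k1 hg); rewrite subrKC => hi.
  have -> : invmx (rp_mx g) - 1%:M = - (invmx (rp_mx g) *m (rp_mx g - 1%:M)).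
    by rewrite mulmxBr mulmx1 mulVmx ?opprB// rational_unit.
  by apply/mx_geN; rewrite -[k]add0r; apply: mx_geM.
Qed.

Lemma congruence_open k : open (congruence_set k).
Proof.
rewrite openE => g hg; apply/nbhs_rationalP; exists k => h hh.
exact: mx_ge_trans hh hg.
Qed.

Lemma congruence_closed k : closed (congruence_set k).
Proof.
rewrite -openC openE => g hg; apply/nbhs_rationalP; exists k => h hh hh'; apply: hg.
exact: mx_ge_trans (mx_ge_sym hh) hh'.
Qed.

Lemma small_compact_subgroups (K0 : set G) :
  is_subgroup K0 -> open K0 -> compact K0 ->
  exists K : nat -> set G,
    [/\ forall i, is_subgroup (K i), forall i, open (K i), forall i, compact (K i)
      & forall U : set G, nbhs 1%g U -> \forall i \near \oo, K i `<=` U].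
Proof.
(* Compactness is inherited from [K0]. The index is shifted by one because at level 0 the inverse of
   an integral matrix may fail to be integral. *)
move=> [K01 K0M K0V] oK0 cK0; exists (fun i => K0 `&` congruence_set (i%:Z + 1)); split.
- move=> i; have [|C1 CM CV] := @congruence_subgroup (i%:Z + 1); first lia.
  split=> [|x y [x0 xC] [y0 yC]|x [x0 xC]]; first by [].
    by split; [exact: K0M|exact: CM].
  by split; [exact: K0V|exact: CV].
- by move=> i; apply: openI => //; exact: congruence_open.
- by move=> i; apply: compact_closedI => //; exact: congruence_closed.
move=> U /nbhs_rationalP[k hk]; exists (absz k) => // i /= ki h [_ hh].
by apply: hk; apply: mx_geW hh; lia.
Qed.

Lemma mx_eval_near (p : mpoly (n * n) F) (l : 'M[F]_n) k :
  exists k', forall A, mx_ge k' (A - l) -> vge k (mx_eval p A - mx_eval p l).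
Proof.
rewrite /mx_eval; elim/mpolyind: p k => [|c m p _ _ IH] k.
  by exists 0 => A _; rewrite !meval0 subrr; left.
have [N N0 hN] := val_ge_exists c.
have [k1 hk1] := IH k.
have [k2 hk2] : exists k', forall A : 'M[F]_n, mx_ge k' (A - l) ->
    vge (k - N) (meval (fun i => mxvec A ord0 i) (mpolyX F m)
                 - meval (fun i => mxvec l ord0 i) (mpolyX F m)).
  have hpow (a0 : F) (e : nat) j : exists j', forall a, vge j' (a - a0) ->
      vge j (a ^+ e - a0 ^+ e).
    have [j' hj'] := prod_near (iota 0 e) (fun=> a0) j.
    exists j' => a ha; have := hj' (fun=> a) (fun=> ha).
    by rewrite !big_const_seq !count_predT !size_iota -!Monoid.iteropE.
  have [k0 hk0] := prod_near (index_enum 'I_(n * n)) (fun i => mxvec l ord0 i ^+ m i) (k - N).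
  have /choice[f fP] (i : 'I_(n * n)) := hpow (mxvec l ord0 i) (m i) k0.
  have [M hM] := finite_int_bound f.
  exists M => A hA; rewrite !mevalX; apply: hk0 => i; apply: fP.
  case/mxvec_indexP: i (hM i) => i j hij; rewrite !mxvecE.
  by have := hA i j; rewrite !mxE; apply: val_geW.
exists (`|k1| + `|k2|) => A hA; rewrite !mevalD !mevalZ opprD addrACA -mulrBr.
apply: val_geD; last by apply: hk1; apply: mx_geW hA; lia.
have h2 := hk2 A (_ : mx_ge k2 _).
by apply: val_geW (val_geM hN (h2 (mx_geW _ hA))); lia.
Qed.

(* The stabiliser of the lattice of vectors whose [g]-orbit is integral. *)
Lemma compact_element_bounded g :
  (forall u, bounded_orbit (rp_mx g) u) ->
  (forall u, bounded_orbit (rp_mx g^-1%g) u) -> compact_element g.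
Proof.
move=> hg hg'.
have [N N0 hN] : exists2 N : int, 0 <= N &
    forall k : nat, mx_ge (- N) (rp_mx g ^+ k) /\ mx_ge (- N) (rp_mx g^-1%g ^+ k).
  have [N N0 hN] := @bounded_orbit_row _ _ _ _ 1%:M (fun i => hg (row i 1%:M)).
  have [M M0 hM] := @bounded_orbit_row _ _ _ _ 1%:M (fun i => hg' (row i 1%:M)).
  exists (N + M) => [|k]; first lia.
  have := hN k; have := hM k; rewrite !mul1mx => h1 h2.
  by split; [apply: mx_geW h2|apply: mx_geW h1]; lia.
(* [L] is a lattice squeezed between the vectors divisible by the [N]-th power of a uniformiser
   ([Ls]) and the integral ones ([L0]); its stabiliser therefore has entries bounded by [- N]. *)
pose L (u : 'rV[F]_n) := forall k : nat,
  mx_ge 0 (u *m rp_mx g ^+ k) /\ mx_ge 0 (u *m rp_mx g^-1%g ^+ k).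
have LD u w : L u -> L w -> L (u + w).
  by move=> hu hw k; rewrite !mulmxDl; have [? ?] := hu k; have [? ?] := hw k;
     split; exact: mx_geD.
have L0 u : L u -> mx_ge 0 u by move=> /(_ 0%N)[]; rewrite expr0 mulmx1.
have Ls u : mx_ge N u -> L u.
  by move=> hu k; have [h1 h2] := hN k; split; rewrite -(addrN N); exact: mx_geM.
pose C := [set h : G | forall u, L u <-> L (u *m rp_mx h)].
have Cg : C g.
  have gu := rational_unit g; rewrite /C/= => u; rewrite /L rp_mxV; split=> hu k.
    split; first by rewrite -mulmxA mulmxE -exprS; exact: (hu k.+1).1.
    case: k => [|k]; first by have [] := hu 1%N; rewrite expr0 mulmx1 expr1.
    by rewrite exprS -mulmxE mulmxA mulmxK//; exact: (hu k).2.
  split; last by have [_] := hu k.+1; rewrite exprS -mulmxE mulmxA mulmxK.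
  case: k => [|k]; first by have [_] := hu 1%N; rewrite expr0 mulmx1 expr1 mulmxK.
  by rewrite exprS -mulmxE mulmxA; exact: (hu k).1.
have Csub : is_subgroup C.
  split=> [u|x y Cx Cy u|x Cx u] /=; first by rewrite -{1}(mulmx1 u).
    change (L u <-> L (u *m (rp_mx x *m rp_mx y))).
    by rewrite mulmxA -Cy -Cx.
  change (L u <-> L (u *m invmx (rp_mx x))).
  by rewrite [X in _ <-> X]Cx mulmxKV// rational_unit.
have Cbound h : C h -> mx_ge (- N) (rp_mx h).
  move=> Ch i j; have [p p0 vp] := valuation_surj F N.
  have hpL : L (p *: row i 1%:M).
    apply: Ls; rewrite -[N]addr0; apply: mx_geZ; first by right; rewrite vp.
    by move=> a b; rewrite mxE; exact: mx_ge1.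
  have := L0 _ ((Ch _).1 hpL) ord0 j.
  rewrite -scalemxAl -row_mul mul1mx !mxE => h0.
  rewrite -(mulKf p0 (rp_mx h i j)) -[- N]addr0; apply: val_geM => //.
  by right; rewrite valuationV// vp.
exists C; split=> // U UP UC.
(* Compactness of [C]: bounded matrices have a cluster point [l], and it remains to place [l] in the
   group and in the stabiliser. *)
have [l lP] : exists l, forall k A, U A -> exists2 t : G, A t & mx_ge k (rp_mx t - l).
  apply: (@mx_ge_cluster _ _ _ _ _ (fun t : G => rp_mx t) (- N)).
  by apply: filterS UC => t; exact: Cbound.
(* Precision [1 + N] makes [l] invertible; the other [N] absorbs the denominators of vectors of size
   [- N], so that [l - t] sends them into [L]. *)
have [t Ct ht] := lP (1 + N + N) _ UC.
have CVt : C t^-1%g by case: Csub => _ _; apply.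
have [lu hlV] : l \in unitmx /\ mx_ge (- N) (invmx l).
  apply: (@invmx_near_bound _ _ (rp_mx t)) => //; first exact: rational_unit.
    by rewrite -rp_mxV; exact: Cbound.
  by apply: mx_ge_sym; apply: mx_geW ht; lia.
have lR : rational_pred l.
  rewrite /rational_pred/= lu/=; apply/allP => p pin; apply/eqP/val_ge_eq0 => k.
  have [k' hk'] := mx_eval_near p l k.
  have [t' Ct' ht'] := lP k' _ UC.
  have := hk' _ ht'; case: t' {Ct' ht'} => t' /= /andP[_ /allP/(_ _ pin)/eqP ->].
  by rewrite sub0r => /val_geN.
exists (RationalPoint lR); split.
  move=> u /=; rewrite (Ct u); split=> hu.
    rewrite -(subrK (rp_mx t) l) mulmxDr addrC; apply: LD => //; apply: Ls.
    have := L0 _ ((Ct u).2 hu) => u0; rewrite -[N]add0r; apply: mx_geM => //.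
    by apply: mx_ge_sym; apply: mx_geW ht; lia.
  rewrite -(subrK l (rp_mx t)) mulmxDr addrC; apply: LD => //; apply: Ls.
  have u0 : mx_ge (- N) u by rewrite -(mulmxK lu u) -[- N]add0r; apply: mx_geM => //; exact: L0.
  by apply: mx_geW (mx_geM u0 ht); lia.
move=> A B UA /nbhs_rationalP[k hk]; have [t' At' ht'] := lP k A UA.
by exists t'; split=> //; exact: hk.
Qed.

Definition rational_cocycle g h : int := volume_cocycle (rp_mx g) (rp_mx h).

Lemma rational_cocycleM g h h' :
  rational_cocycle g (h * h')%g = rational_cocycle g h + rational_cocycle (h^-1 * g * h)%g h'.
Proof. by rewrite /rational_cocycle rp_mxM volume_cocycleM ?rational_unit. Qed.

Lemma rational_cocycle_near (g h : G) :
  \forall p \near (g, h), rational_cocycle p.1 p.2 = rational_cocycle g h.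
Proof.
have [k hk] := volume_cocycle_near (rp_mx g) (rational_unit h).
exists ([set g' : G | mx_ge k (rp_mx g' - rp_mx g)],
        [set h' : G | mx_ge k (rp_mx h' - rp_mx h)]).
  by split; apply/nbhs_rationalP; exists k.
by move=> [g' h'] [/= hg hh]; exact: hk.
Qed.

Lemma rational_cocycle_exp g m : (0 < m)%N ->
  rational_cocycle (g ^+ m)%g (g ^+ m)%g = rational_cocycle g g *+ m.
Proof.
by move=> m0; rewrite /rational_cocycle rp_mxX volume_cocycle_self_exp ?rational_unit.
Qed.

Lemma compact_element_cocycle g :
  rational_cocycle g g = 0 -> rational_cocycle g^-1%g g^-1%g = 0 -> compact_element g.
Proof.
move=> h1 h2; apply: compact_element_bounded; apply: volume_cocycle_eq0 => //;
  exact: rational_unit.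
Qed.

End RationalPointsTopology.

(** * The cocenter of a Hecke algebra *)

Definition locally_const (X : topologicalType) (Y : Type) (f : X -> Y) :=
  forall x, \forall x' \near x, f x' = f x.

Lemma locally_const_comp (X X' : topologicalType) (Y : Type) (f : X' -> Y) (h : X -> X') :
  continuous h -> locally_const f -> locally_const (f \o h).
Proof. by move=> hc lf x; exact: (hc x _ (lf (h x))). Qed.

Lemma locally_const2 (X : topologicalType) (Y Y' Z : Type) (op : Y -> Y' -> Z)
    (f : X -> Y) (g : X -> Y') :
  locally_const f -> locally_const g -> locally_const (fun x => op (f x) (g x)).
Proof. by move=> lf lg x; apply: filterS2 (lf x) (lg x) => x' -> ->. Qed.

Lemma locally_const1 (X : topologicalType) (Y Z : Type) (op : Y -> Z) (f : X -> Y) :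
  locally_const f -> locally_const (fun x => op (f x)).
Proof. by move=> lf x; apply: filterS (lf x) => x' ->. Qed.

Lemma locally_const_closed (X : topologicalType) (Y : Type) (f : X -> Y) (A : set Y) :
  locally_const f -> closed [set x | A (f x)].
Proof.
move=> lf; rewrite -openC openE => x /= nA; apply: filterS (lf x) => x' /= -> //.
Qed.

(* The parameter [q] is a small perturbation around [q0]; [L] is a base of
   neighbourhoods of [q0]. *)
Lemma uniform_locally_const (X Q : topologicalType) (Y : Type) (Om : set X) (f : X -> Y)
    (m : X * Q -> X) (q0 : Q) (L : nat -> set Q) :
  compact Om -> locally_const f -> continuous m -> (forall x, m (x, q0) = x) ->
  (forall U, nbhs q0 U -> \forall i \near \oo, L i `<=` U) ->
  \forall i \near \oo, forall x q, Om x -> L i q -> f (m (x, q)) = f x.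
Proof.
move=> cO lf mc m0 hL.
have h := (compact_near_coveringP Om).1 cO nat \oo
  (fun i x => forall q, L i q -> f (m (x, q)) = f x) eventually_filter.
have : \forall i \near \oo, Om `<=` (fun x => forall q, L i q -> f (m (x, q)) = f x).
  apply: h => x Ox.
  have := mc (x, q0) [set y | f y = f (m (x, q0))] (lf _).
  move=> [[A B] [/= Ax Bq] AB].
  have h1 : nbhs x (A `&` [set x' | f x' = f x]) by apply: filterI => //; exact: lf.
  have h2 := hL _ Bq.
  exists (A `&` [set x' | f x' = f x], [set i | L i `<=` B]); first by split.
  move=> [x' i] [/= [Ax' fx'] LB] q Lq.
  have := AB (x', q) (conj Ax' (LB _ Lq)) => /= ->.
  by rewrite m0 fx'.
by apply: filterS => i hi x q Ox Lq; exact: hi.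
Qed.

Section Hecke.
Variables (R : fieldType) (G : groupWithTopologyType).
Hypothesis mulc : continuous (fun p : G * G => (p.1 * p.2)%g).
Hypothesis invc : continuous (fun g : G => g^-1%g).

Lemma continuous_mulg (X : topologicalType) (f g : X -> G) :
  continuous f -> continuous g -> continuous (fun x => (f x * g x)%g).
Proof.
move=> fc gc x A /(@mulc (f x, g x) _)[[B C] [/= Bx Cx] BC].
have Bf : nbhs x (f @^-1` B) := fc x _ Bx.
have Cg : nbhs x (g @^-1` C) := gc x _ Cx.
suff : nbhs x ((fun x => f x * g x)%g @^-1` A) by [].
apply: filterS (filterI Bf Cg) => y [By Cy].
exact: (BC (f y, g y)).
Qed.

Lemma continuous_invg (X : topologicalType) (f : X -> G) :
  continuous f -> continuous (fun x => (f x)^-1%g).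
Proof. by move=> fc x; apply: (@cvg_comp _ _ _ f (fun g => g^-1%g)); [exact: fc|exact: invc]. Qed.

Lemma continuous_id (X : topologicalType) : continuous (fun x : X => x).
Proof. by move=> x. Qed.

Lemma continuous_fst (X Y : topologicalType) : continuous (fun p : X * Y => p.1).
Proof. by move=> x; exact: cvg_fst. Qed.

Lemma continuous_snd (X Y : topologicalType) : continuous (fun p : X * Y => p.2).
Proof. by move=> x; exact: cvg_snd. Qed.

Lemma continuous_pair (X Y Z : topologicalType) (f : X -> Y) (g : X -> Z) :
  continuous f -> continuous g -> continuous (fun x => (f x, g x)).
Proof. by move=> fc gc x; apply: cvg_pair; [exact: fc|exact: gc]. Qed.

Lemma continuous_comp2 (X Y Z : topologicalType) (f : X -> Y) (g : Y -> Z) :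
  continuous f -> continuous g -> continuous (fun x => g (f x)).
Proof. by move=> fc gc x; apply: cvg_comp (fc x) (gc _). Qed.

Implicit Types f : G -> R^o.
Local Notation hecke_pred := (@hecke_pred R G).

(** For a locally constant function the nonvanishing locus is already closed. *)
Lemma heckeP f : f \in hecke_pred <->
  locally_const f /\ compact [set x | f x != 0].
Proof.
split=> [/asboolP[lf cf]|[lf cf]].
  split=> //; have cl := @locally_const_closed _ _ f [set y | y != 0] lf.
  by move: cf; rewrite /compactly_supported -(closure_id _).1.
apply/asboolP; split=> //; have cl := @locally_const_closed _ _ f [set y | y != 0] lf.
by rewrite /compactly_supported -(closure_id _).1.
Qed.

Lemma hecke_lc (f : hecke R G) : locally_const f.
Proof. by have /heckeP[] := valP f. Qed.

Lemma hecke_compact (f : hecke R G) : compact [set x | f x != 0].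
Proof. by have /heckeP[] := valP f. Qed.

Lemma hecke_ext f (g : G -> R^o) : (forall x, f x = g x) -> g \in hecke_pred -> f \in hecke_pred.
Proof. by move=> /funext ->. Qed.

Lemma hecke_scale (phi : G -> R) f : locally_const phi -> f \in hecke_pred ->
  (fun x => phi x * f x : R^o) \in hecke_pred.
Proof.
move=> lp /heckeP[lf cf]; apply/heckeP; have lpf := locally_const2 *%R lp lf; split=> //.
apply: (subclosed_compact _ cf).
  exact: (@locally_const_closed _ _ _ [set y | y != 0] lpf).
by move=> x /=; apply: contra_neq => ->; rewrite mulr0.
Qed.

Lemma hecke_homeo (t t' : G -> G) f : continuous t -> continuous t' ->
  (forall x, t' (t x) = x) -> (forall x, t (t' x) = x) ->
  f \in hecke_pred -> (f \o t : G -> R^o) \in hecke_pred.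
Proof.
move=> tc t'c tK t'K /heckeP[lf cf]; apply/heckeP; split.
  exact: locally_const_comp.
have -> : [set x | (f \o t) x != 0] = t' @` [set x | f x != 0].
  apply/seteqP; split=> [x fx|_ [x fx <-]]; first by exists (t x).
  by rewrite /= t'K.
by apply: continuous_compact => //; exact: continuous_subspaceT.
Qed.

Lemma hecke_translate s f : f \in hecke_pred -> (fun x => f (s^-1 * x)%g) \in hecke_pred.
Proof.
apply: (@hecke_homeo (fun x => s^-1 * x)%g (fun x => s * x)%g).
- by apply: continuous_mulg; [exact: cst_continuous|exact: continuous_id].
- by apply: continuous_mulg; [exact: cst_continuous|exact: continuous_id].
- by move=> x; rewrite mulgA mulgV mul1g.
- by move=> x; rewrite mulgA mulVg mul1g.
Qed.

(** The default 0 is taken only when the product is not a Hecke function, which cannot happen for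
    locally constant [phi]. *)
Definition pointwise_mul (phi : G -> R) (f : hecke R G) : hecke R G :=
  insubd 0 (fun x => phi x * f x : R^o).

Lemma pointwise_mulE phi (f : hecke R G) x : locally_const phi ->
  pointwise_mul phi f x = phi x * f x.
Proof.
move=> lp; have h : (fun x => phi x * f x : R^o) \in hecke_pred.
  exact: hecke_scale (valP f).
by rewrite -[hecke_fun _]/(val _) val_insubd ifT.
Qed.

Lemma heckeD (f g : hecke R G) x : (f + g) x = f x + g x.
Proof. by []. Qed.

Lemma heckeZ a (f : hecke R G) x : (a *: f) x = a * f x.
Proof. by []. Qed.

Lemma hecke0 x : (0 : hecke R G) x = 0.
Proof. by []. Qed.

Lemma hecke_sum (J : Type) (r : seq J) (P : pred J) (F : J -> hecke R G) x :
  (\sum_(j <- r | P j) F j) x = \sum_(j <- r | P j) F j x.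
Proof. by elim/big_rec2: _ => // j y h _ <-; rewrite heckeD. Qed.

Lemma heckeI (f g : hecke R G) : (forall x, f x = g x) -> f = g.
Proof. by move=> fg; apply: val_inj; apply/funext. Qed.

Variable I : (G -> R^o) -> R.
Hypothesis haarI : haar_integral I.

Lemma integralD f (g : G -> R^o) : f \in hecke_pred -> g \in hecke_pred -> I (fun x => f x + g x) = I f + I g.
Proof.
move=> hf hg; case: haarI => lin _ _; have := lin 1 (Hecke hf) (Hecke hg).
by rewrite mul1r => <-; congr I; apply/funext => x /=; rewrite fctE /= scale1r.
Qed.

Lemma integral0 : I (fun=> 0) = 0.
Proof.
case: haarI => lin _ _; have := lin 1 0 0; rewrite mul1r scale1r addr0.
by move=> /eqP; rewrite -subr_eq0 opprD addNKr oppr_eq0 => /eqP.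
Qed.

Lemma integralZ (a : R) f : f \in hecke_pred -> I (fun x => a * f x) = a * I f.
Proof.
move=> hf; case: haarI => lin _ _; have := lin a (Hecke hf) 0.
have -> : I (0 : hecke R G) = 0 by exact: integral0.
rewrite [X in _ = X]addr0 => <-; congr I; apply/funext => x.
by rewrite /= fctE /= addr0.
Qed.

Lemma integral_sum (J : Type) (r : seq J) (F : J -> G -> R^o) :
  (forall j, F j \in hecke_pred) -> I (fun x => \sum_(j <- r) F j x) = \sum_(j <- r) I (F j).
Proof.
move=> hF; elim: r => [|j r IH].
  by rewrite big_nil -[RHS]integral0; congr I; apply/funext => x; rewrite big_nil.
rewrite big_cons -IH -integralD//.
  by congr I; apply/funext => x; rewrite big_cons.
have -> : (fun x => \sum_(j <- r) F j x) = \sum_(j <- r) F j.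
  by apply/funext => x; rewrite fct_sumE.
exact: rpred_sum.
Qed.

Lemma integral_translate y f : f \in hecke_pred -> I (fun x => f (y^-1 * x)%g) = I f.
Proof. by move=> hf; case: haarI => _ inv _; exact: (inv y (Hecke hf)). Qed.

Definition compact_open_subgroup (L : set G) := [/\ is_subgroup L, open L & compact L].

(** * Decomposition into cosets of a compact open subgroup *)

Section Cosets.
Variables (L : set G) (hL : compact_open_subgroup L).

Lemma subgroupM x y : L x -> L y -> L (x * y)%g.
Proof. by case: hL => -[_ LM _] _ _; exact: LM. Qed.

Lemma subgroupV x : L x -> L x^-1%g.
Proof. by case: hL => -[_ _ LV] _ _; exact: LV. Qed.

Lemma coset_trans x y z : L (x^-1 * y)%g -> L (y^-1 * z)%g -> L (x^-1 * z)%g.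
Proof. by move=> xy yz; have := subgroupM xy yz; rewrite mulgA mulgK. Qed.

Lemma coset_sym x y : L (x^-1 * y)%g -> L (y^-1 * x)%g.
Proof. by move=> /subgroupV; rewrite invgM invgK. Qed.

Lemma coset_refl x : L (x^-1 * x)%g.
Proof. by rewrite mulVg; case: hL => -[]. Qed.

Lemma open_coset s : open [set x | L (s^-1 * x)%g].
Proof.
have -> : [set x | L (s^-1 * x)%g] = (fun x => s^-1 * x)%g @^-1` L by [].
apply: open_comp; last by case: hL.
by move=> x _; apply: continuous_mulg; [exact: cst_continuous|exact: continuous_id].
Qed.

Lemma coset_locally_const s : locally_const (fun x => `[< L (s^-1 * x)%g >]).
Proof.
move=> x; have : nbhs x [set x' | L (x^-1 * x')%g].
  by apply: open_nbhs_nbhs; split; [exact: open_coset|exact: coset_refl].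
apply: filterS => x' /= xx'; apply/asbool_equiv_eq; split=> h.
  exact: coset_trans h (coset_sym xx').
exact: coset_trans h xx'.
Qed.

Lemma coset_hecke s : (fun x => (`[< L (s^-1 * x)%g >])%:R : R^o) \in hecke_pred.
Proof.
apply/heckeP; split; first exact: (locally_const1 (fun b : bool => b%:R : R^o) (coset_locally_const s)).
have -> : [set x | (`[< L (s^-1 * x)%g >])%:R != 0 :> R^o] = (fun x => s * x)%g @` L.
  apply/seteqP; split=> [x /=|_ [x Lx <-] /=].
    case: asboolP => [h _|_]; last by rewrite eqxx.
    by exists (s^-1 * x)%g => //; rewrite mulVKg.
  by rewrite mulKg asboolT// oner_neq0.
apply: continuous_compact; last by case: hL.
apply: continuous_subspaceT.
by apply: continuous_mulg; [exact: cst_continuous|exact: continuous_id].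
Qed.

Definition coset_fun s : hecke R G := Hecke (coset_hecke s).

Lemma coset_funE s x : coset_fun s x = (`[< L (s^-1 * x)%g >])%:R.
Proof. by []. Qed.

Definition coset_reps (Om : set G) N (s : 'I_N -> G) :=
  [/\ forall i, Om (s i), forall x, Om x -> exists i, L ((s i)^-1 * x)%g
    & forall i j, L ((s i)^-1 * s j)%g -> i = j].

Lemma coset_reps_exist (Om : set G) : compact Om -> exists N (s : 'I_N -> G), coset_reps Om s.
Proof.
move=> cO.
(* Finite lists directed by inclusion: compactness, in its near-covering form along this filter,
   yields a finite list of centres. The list is then pruned so that distinct entries lie in distinct
   cosets. *)
pose FF : set_system (seq G) := [set P : set (seq G) | exists l0 : seq G, forall l : seq G, {subset l0 <= l} -> P l].
have filterFF : Filter FF.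
  split=> [|P Q [l Pl] [l' Ql']|P Q PQ [l Pl]]; first by exists [::].
    exists (l ++ l') => m lm; split; [apply: Pl|apply: Ql'] => g gl; apply: lm;
      by rewrite mem_cat gl ?orbT.
  by exists l => m /Pl /PQ.
have [D /(_ D (fun _ h => h)) cD] : FF (fun l => Om `<=`
    (fun x => exists g, [/\ g \in l, Om g & L (g^-1 * x)%g])).
  apply: ((compact_near_coveringP Om).1 cO _ _ (fun (l : seq G) x =>
    exists g, [/\ g \in l, Om g & L (g^-1 * x)%g]) filterFF) => x Ox.
  exists ([set x' | L (x^-1 * x')%g], [set l : seq G | x \in l]).
    split=> /=; last by exists [:: x] => l; apply; rewrite inE eqxx.
    by apply: open_nbhs_nbhs; split; [exact: open_coset|exact: coset_refl].
  by move=> [x' l] [/= xx' xl]; exists x.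
have [l [lO lC lU]] : exists l : seq G, [/\ forall g, g \in l -> Om g,
    forall x, Om x -> exists2 g, g \in l & L (g^-1 * x)%g
    & forall i j, (i < size l)%N -> (j < size l)%N ->
        L ((nth 1%g l i)^-1 * nth 1%g l j)%g -> i = j].
  have : exists l : seq G, (forall g, g \in l -> Om g) /\
      (forall x, Om x -> exists2 g, g \in l & L (g^-1 * x)%g).
    exists [seq g <- D | `[< Om g >]]; split=> [g|x /cD[g [gD Og gx]]].
      by rewrite mem_filter => /andP[/asboolP].
    by exists g; rewrite // mem_filter gD asboolT.
  move=> [l [lO lC]].
  have [l' [l'l l'C l'U]] : exists l' : seq G, [/\ {subset l' <= l},
      forall g, g \in l -> exists2 g', g' \in l' & L (g'^-1 * g)%g
      & forall i j, (i < size l')%N -> (j < size l')%N ->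
        L ((nth 1%g l' i)^-1 * nth 1%g l' j)%g -> i = j].
    elim: l {lO lC} => [|a l [l' [l'l l'C l'U]]]; first by exists [::].
    have [[g' g'l ag']|na] := pselect (exists2 g', g' \in l' & L (g'^-1 * a)%g).
      exists l'; split=> // [g /l'l gl|g]; first by rewrite inE gl orbT.
      by rewrite inE => /orP[/eqP->|/l'C//]; exists g'.
    exists (a :: l'); split=> [g|g|].
    - by rewrite !inE => /orP[->//|/l'l ->]; rewrite orbT.
    - rewrite inE => /orP[/eqP->|/l'C[g' g'l gg']].
        by exists a; [rewrite inE eqxx|exact: coset_refl].
      by exists g' => //; rewrite inE g'l orbT.
    move=> [|i] [|j] //= hi hj h.
    - by case: na; exists (nth 1%g l' j); [exact: mem_nth|exact: coset_sym].
    - by case: na; exists (nth 1%g l' i); [exact: mem_nth|].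
    - by congr _.+1; exact: l'U.
  exists l'; split=> // [g /l'l/lO//|x Ox].
  have [g /l'C[g' g'l gg'] gx] := lC x Ox.
  by exists g' => //; exact: coset_trans gg' gx.
exists (size l), (fun i => nth 1%g l i); split=> [i|x /lC[g gl gx]|i j h].
- by apply: lO; exact: mem_nth.
- by exists (Ordinal (etrans (index_mem g l) gl)); rewrite /= nth_index.
- by apply: val_inj; exact: lU h.
Qed.

Definition right_invariant (f : G -> R^o) := forall x k, L k -> f (x * k)%g = f x.
Definition left_invariant (f : G -> R^o) := forall x k, L k -> f (k * x)%g = f x.

Lemma coset_decomposition (Om : set G) N (s : 'I_N -> G) (f : hecke R G) :
  coset_reps Om s -> right_invariant f -> (forall x, f x != 0 -> Om x) ->
  f = \sum_i (f (s i) : R) *: coset_fun (s i).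
Proof.
move=> [sO sC sU] fr fO; apply: heckeI => x; rewrite hecke_sum.
under eq_bigr do rewrite heckeZ coset_funE.
have [[i ix]|no] := pselect (exists i, L ((s i)^-1 * x)%g).
  rewrite (bigD1 i)//= asboolT// mulr1 big1 ?addr0; last first.
    move=> j ji; rewrite asboolF ?mulr0// => jx.
    by rewrite (sU j i (coset_trans jx (coset_sym ix))) eqxx in ji.
  by rewrite -(fr (s i) _ ix) mulVKg.
rewrite big1; last by move=> i _; rewrite asboolF ?mulr0// => ix; apply: no; exists i.
by apply/eqP/negPn/negP => /fO/sC.
Qed.

End Cosets.

Lemma subset_coset_fun (L : set G) (hL : compact_open_subgroup L) s x :
  coset_fun hL s x != 0 -> L (s^-1 * x)%g.
Proof. by rewrite coset_funE; case: asboolP => // _; rewrite eqxx. Qed.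

(** * The convolution algebra and its cocenter *)

Section Convolution.
Variable K : nat -> set G.
Hypothesis KP : forall i, compact_open_subgroup (K i).
Hypothesis KB : forall U : set G, nbhs 1%g U -> \forall i \near \oo, K i `<=` U.

Lemma right_invariant_near (f : hecke R G) : \forall i \near \oo, right_invariant (K i) f.
Proof.
have mc : continuous (fun p : G * G => (p.1 * p.2)%g) by exact: mulc.
have := uniform_locally_const (@hecke_compact f) (@hecke_lc f) mc (@mulg1 G) KB.
apply: filterS => i hi x k Kk.
(* [hi] speaks of points of the support only. If [x] lies outside but [x * k] inside, applying it to
   [x * k] and the inverse of [k] gives a contradiction. *)
have [fx|fx] := eqVneq (f x) 0; last exact: hi.
rewrite fx; apply/eqP/negPn/negP => fxk.
by have := hi _ _ fxk (subgroupV (KP i) Kk); rewrite /= mulgK fx => fxk0; rewrite -fxk0 eqxx in fxk.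
Qed.

Lemma left_invariant_near (f : hecke R G) : \forall i \near \oo, left_invariant (K i) f.
Proof.
have mc : continuous (fun p : G * G => (p.2 * p.1)%g).
  by apply: continuous_mulg; [exact: continuous_snd|exact: continuous_fst].
have := uniform_locally_const (@hecke_compact f) (@hecke_lc f) mc (@mul1g G) KB.
apply: filterS => i hi x k Kk.
have [fx|fx] := eqVneq (f x) 0; last exact: hi.
rewrite fx; apply/eqP/negPn/negP => fxk.
by have := hi _ _ fxk (subgroupV (KP i) Kk); rewrite /= mulKg fx => fxk0; rewrite -fxk0 eqxx in fxk.
Qed.

Lemma convolution_integrand (f g : hecke R G) x :
  (fun y => f y * g (y^-1 * x)%g : R^o) \in hecke_pred.
Proof.
have cy : continuous (fun y : G => y^-1 * x)%g.
  by apply: (@continuous_mulg _ (fun y : G => y^-1)%g (fun=> x)); [exact: invc|exact: cst_continuous].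
have lg : locally_const (fun y => g (y^-1 * x)%g : R) := locally_const_comp cy (@hecke_lc g).
by apply: hecke_ext (hecke_scale lg (valP f)) => y; rewrite mulrC.
Qed.

Lemma convolution_sumr (J : finType) (E : J -> R) (U : J -> hecke R G) (f : hecke R G) x :
  convolution I f (\sum_j E j *: U j : hecke R G) x =
  \sum_j E j * convolution I f (U j) x.
Proof.
transitivity (\sum_j I (fun y => E j * (f y * U j (y^-1 * x)%g))); last first.
  by apply: eq_bigr => j _; apply: integralZ; exact: convolution_integrand.
rewrite -integral_sum; last first.
  move=> j; apply: hecke_ext (convolution_integrand f (E j *: U j) x) => y.
  by rewrite heckeZ mulrCA.
rewrite /convolution; congr I; apply/funext => y; rewrite hecke_sum mulr_sumr.
by apply: eq_bigr => j _; rewrite heckeZ mulrCA.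
Qed.

Lemma convolution_suml (J : finType) (E : J -> R) (U : J -> hecke R G) (f : hecke R G) x :
  convolution I (\sum_j E j *: U j : hecke R G) f x =
  \sum_j E j * convolution I (U j) f x.
Proof.
transitivity (\sum_j I (fun y => E j * (U j y * f (y^-1 * x)%g))); last first.
  by apply: eq_bigr => j _; apply: integralZ; exact: convolution_integrand.
rewrite -integral_sum; last first.
  move=> j; apply: hecke_ext (convolution_integrand (E j *: U j) f x) => y.
  by rewrite heckeZ mulrA.
rewrite /convolution; congr I; apply/funext => y; rewrite hecke_sum mulr_suml.
by apply: eq_bigr => j _; rewrite heckeZ mulrA.
Qed.

Definition translate (s : G) (f : hecke R G) : hecke R G := Hecke (hecke_translate s (valP f)).

Definition volume i : R := I (coset_fun (KP i) 1%g).

Lemma integral_coset_fun i s : I (coset_fun (KP i) s) = volume i.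
Proof.
rewrite /volume -(integral_translate s (valP (coset_fun (KP i) 1%g))).
by congr I; apply/funext => x; rewrite /= invg1 mul1g.
Qed.

Lemma convolution_coset_fun i s (g : hecke R G) : left_invariant (K i) g ->
  convolution I (coset_fun (KP i) s) g = volume i *: translate s g.
Proof.
move=> gl; apply/funext => x; rewrite /convolution.
transitivity (I (fun y => g (s^-1 * x)%g * coset_fun (KP i) s y)).
  congr I; apply/funext => y; rewrite coset_funE mulrC.
  case: asboolP => [h|_]; last by rewrite !mulr0.
  rewrite -(gl (s^-1 * x)%g _ (subgroupV (KP i) h)) !mulr1.
  by rewrite invgM invgK mulgA mulgK.
rewrite integralZ; last exact: valP.
by rewrite integral_coset_fun; exact: mulrC.
Qed.

(** Cut [f] into cosets of a subgroup fixing [g] on the left: each coset contributes a multiple of a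
    translate of [g]. *)
Lemma convolution_hecke (f g : hecke R G) : convolution I f g \in hecke_pred.
Proof.
have [i [fr gl]] : exists i, right_invariant (K i) f /\ left_invariant (K i) g.
  exact: (filter_ex (filterI (right_invariant_near f) (left_invariant_near g))).
have [N [s hs]] := coset_reps_exist (KP i) (@hecke_compact f).
have -> : convolution I f g = (\sum_j ((f (s j) : R) * volume i) *: translate (s j) g : hecke R G).
  apply/funext => x.
  rewrite {1}(coset_decomposition (KP i) hs fr)// convolution_suml hecke_sum.
  by apply: eq_bigr => j _; rewrite convolution_coset_fun// heckeZ mulrA.
exact: valP.
Qed.

Definition hmul (f g : hecke R G) : hecke R G := Hecke (convolution_hecke f g).

Lemma hmul_suml (J : finType) (E : J -> R) (U : J -> hecke R G) (f : hecke R G) :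
  hmul (\sum_j E j *: U j) f = \sum_j E j *: hmul (U j) f.
Proof.
by apply: heckeI => x; rewrite hecke_sum [LHS]convolution_suml; apply: eq_bigr.
Qed.

Lemma hmul_sumr (J : finType) (E : J -> R) (U : J -> hecke R G) (f : hecke R G) :
  hmul f (\sum_j E j *: U j) = \sum_j E j *: hmul f (U j).
Proof.
by apply: heckeI => x; rewrite hecke_sum [LHS]convolution_sumr; apply: eq_bigr.
Qed.

Lemma hmulZl a (f g : hecke R G) : hmul (a *: f) g = a *: hmul f g.
Proof. by have := hmul_suml (fun=> a) (fun _ : 'I_1 => f) g; rewrite !big_ord1. Qed.

Lemma hmul_coset_fun i s (g : hecke R G) : left_invariant (K i) g ->
  hmul (coset_fun (KP i) s) g = volume i *: translate s g.
Proof. by move=> gl; apply: val_inj; rewrite /= convolution_coset_fun. Qed.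

Lemma hmul_translate s (f g : hecke R G) : hmul (translate s f) g = translate s (hmul f g).
Proof.
apply: heckeI => x; rewrite /= /convolution.
rewrite -(integral_translate s (convolution_integrand f g (s^-1 * x)%g)).
by congr I; apply/funext => y; rewrite invgM invgK mulgA mulgK.
Qed.

Lemma left_invariantE i (f : hecke R G) :
  left_invariant (K i) f <-> forall k, K i k -> translate k f = f.
Proof.
split=> h; first by move=> k Kk; apply: heckeI => x; exact: h (subgroupV (KP i) Kk).
move=> x k Kk; rewrite -[in RHS](h _ (subgroupV (KP i) Kk)) /=.
by rewrite invgK.
Qed.

(** After cutting [f] into cosets, left convolution by [f] is a combination of translations, and
    translations commute with convolution on the right. *)
Lemma hmulA (f g h : hecke R G) : hmul f (hmul g h) = hmul (hmul f g) h.
Proof.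
have [i [fr gl]] : exists i, right_invariant (K i) f /\ left_invariant (K i) g.
  exact: (filter_ex (filterI (right_invariant_near f) (left_invariant_near g))).
have [N [s hs]] := coset_reps_exist (KP i) (@hecke_compact f).
have ghl : left_invariant (K i) (hmul g h).
  by apply/left_invariantE => k Kk; rewrite -hmul_translate (left_invariantE i g).1.
have fE := coset_decomposition (KP i) hs fr (fun _ h => h).
transitivity (\sum_j (f (s j) : R) *: (volume i *: translate (s j) (hmul g h))).
  by rewrite {1}fE hmul_suml; apply: eq_bigr => j _; rewrite hmul_coset_fun.
rewrite [in RHS]fE !hmul_suml; apply: eq_bigr => j _.
by rewrite hmul_coset_fun// hmulZl hmul_translate.
Qed.

Lemma hmul_support (f g : hecke R G) x : hmul f g x != 0 ->
  exists y, f y != 0 /\ g (y^-1 * x)%g != 0.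
Proof.
apply: contra_neqP => /forallNP h; rewrite /= /convolution -[RHS]integral0.
congr I; apply/funext => y; have := h y.
by have [->|fy] := eqVneq (f y) 0; [rewrite mul0r|have [->|gy []] := eqVneq (g (y^-1 * x)%g) 0; rewrite ?mulr0].
Qed.

Definition hclass (f : hecke R G) : cocenter I := cocenter_class I f.

Lemma hclassE (f g : hecke R G) : hclass f = hclass g <-> f - g \in commutator_pred I.
Proof. exact: cocenter_classP. Qed.

Lemma hclassZ a (f : hecke R G) : hclass (a *: f) = a *: hclass f.
Proof. by rewrite /hclass -cocenter_scale_class. Qed.

Lemma hclassD (f g : hecke R G) : hclass (f + g) = hclass f + hclass g.
Proof. exact: cocenter_classD. Qed.

Lemma hclass0 : hclass 0 = 0.
Proof. by rewrite -(scale0r (0 : hecke R G)) hclassZ scale0r. Qed.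

Lemma hclass_sum (J : Type) (r : seq J) (P : pred J) (f : J -> hecke R G) :
  hclass (\sum_(j <- r | P j) f j) = \sum_(j <- r | P j) hclass (f j).
Proof. by rewrite (big_morph hclass hclassD hclass0). Qed.

Lemma hclassC (f g : hecke R G) : hclass (hmul f g) = hclass (hmul g f).
Proof.
apply/hclassE/asboolP; exists [:: (1, hmul f g - hmul g f)]; split=> [c|].
  by rewrite inE => /eqP ->; exists f, g.
by rewrite big_seq1 scale1r.
Qed.

Definition class_function (phi : G -> R) := forall x y, phi (x * y)%g = phi (y * x)%g.

Lemma pointwise_mul_sum phi (J : finType) (E : J -> R) (U : J -> hecke R G) :
  locally_const phi ->
  pointwise_mul phi (\sum_j E j *: U j) = \sum_j E j *: pointwise_mul phi (U j).
Proof.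
move=> lp; apply: heckeI => x; rewrite pointwise_mulE// !hecke_sum mulr_sumr.
by apply: eq_bigr => j _; rewrite !heckeZ pointwise_mulE// mulrCA.
Qed.

Lemma pointwise_mul_const phi a (f : hecke R G) : locally_const phi ->
  (forall x, f x != 0 -> phi x = a) -> pointwise_mul phi f = a *: f.
Proof.
move=> lp h; apply: heckeI => x; rewrite pointwise_mulE// heckeZ.
by have [->|fx] := eqVneq (f x) 0; [rewrite !mulr0|rewrite h].
Qed.

(* On products x = y z with y near s, multiplication by [phi x] amounts to
   multiplication of the second factor by [phi (s z)], whether it is
   convolved on the right or on the left. *)
Lemma hclass_pointwise_mulC phi (f g : hecke R G) : locally_const phi -> class_function phi ->
  hclass (pointwise_mul phi (hmul f g)) = hclass (pointwise_mul phi (hmul g f)).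
Proof.
move=> lp cp.
pose m (p : (G * G) * G) := ((p.1.1 * p.2)%g, p.1.2).
have mc : continuous m.
  apply: continuous_pair; last exact: continuous_comp2 (@continuous_fst _ _) (@continuous_snd _ _).
  apply: continuous_mulg; last exact: continuous_snd.
  exact: continuous_comp2 (@continuous_fst _ _) (@continuous_fst _ _).
have cfg : compact ([set x | f x != 0] `*` [set x | g x != 0]).
  exact: compact_setX (@hecke_compact f) (@hecke_compact g).
have lphi : locally_const (fun p : G * G => phi (p.1 * p.2)%g).
  exact: locally_const_comp mulc lp.
have m1 p : m (p, 1%g) = p by case: p => x y; rewrite /m/= mulg1.
have U := uniform_locally_const cfg lphi mc m1 KB.
have [i [fr hU]] := filter_ex (filterI (right_invariant_near f) U).
have [N [s hs]] := coset_reps_exist (KP i) (@hecke_compact f).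
rewrite (coset_decomposition (KP i) hs fr (fun _ h => h)) hmul_suml hmul_sumr.
rewrite !pointwise_mul_sum// !hclass_sum; apply: eq_bigr => j _; rewrite !hclassZ.
congr (_ *: _); set a := coset_fun _ _.
have phis : locally_const (fun y => phi (s j * y)%g).
  have cy : continuous (fun y : G => s j * y)%g.
    by apply: continuous_mulg; [exact: cst_continuous|exact: continuous_id].
  exact: locally_const_comp cy lp.
have [sO _ _] := hs.
have phiE k y : K i k -> g y != 0 -> phi (s j * k * y)%g = phi (s j * y)%g.
  by move=> Kk gy; apply: (hU (s j, y) k); rewrite //; split => //; exact: sO.
have aE y : a y = (`[< K i ((s j)^-1 * y)%g >])%:R by [].
set b := pointwise_mul (fun y => phi (s j * y)%g) g.
transitivity (hclass (hmul a b)).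
  congr hclass; apply: heckeI => x; rewrite pointwise_mulE//.
  transitivity (I (fun y => phi x * (a y * g (y^-1 * x)%g))).
    by symmetry; apply: integralZ; exact: convolution_integrand.
  rewrite -[RHS]/(I (fun y => a y * b (y^-1 * x)%g)); congr I; apply/funext => y.
  rewrite pointwise_mulE// aE.
  case: asboolP => [h|_]; last by rewrite !mul0r mulr0.
  rewrite mulrCA; congr (_ * _).
  have [->|gy] := eqVneq (g (y^-1 * x)%g) 0; first by rewrite !mulr0.
  by rewrite -(phiE _ _ h gy) mulVKg mulVKg.
rewrite hclassC; congr hclass; apply: heckeI => x; rewrite pointwise_mulE//.
transitivity (I (fun y => phi x * (g y * a (y^-1 * x)%g))); last first.
  by apply: integralZ; exact: convolution_integrand.
rewrite -[LHS]/(I (fun y => b y * a (y^-1 * x)%g)); congr I; apply/funext => y.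
rewrite pointwise_mulE// aE.
case: asboolP => [h|_]; last by rewrite !mulr0.
rewrite !mulr1; have [->|gy] := eqVneq (g y) 0; first by rewrite !mulr0.
by rewrite -(phiE _ _ h gy) mulVKg cp mulVKg.
Qed.

(** By [hclass_pointwise_mulC], truncating a commutator gives 0 in the cocenter, so truncation by
    level is well defined there. *)
Lemma hclass_pointwise_mul phi (f g : hecke R G) : locally_const phi -> class_function phi ->
  hclass f = hclass g -> hclass (pointwise_mul phi f) = hclass (pointwise_mul phi g).
Proof.
move=> lp cp /hclassE/asboolP[l [lP fgE]].
have -> : f = g + (f - g) by rewrite addrC subrK.
have pmD (a b : hecke R G) : pointwise_mul phi (a + b) = pointwise_mul phi a + pointwise_mul phi b.
  by apply: heckeI => x; rewrite heckeD !pointwise_mulE// heckeD mulrDr.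
have pmZ a (b : hecke R G) : pointwise_mul phi (a *: b) = a *: pointwise_mul phi b.
  by apply: heckeI => x; rewrite heckeZ !pointwise_mulE// heckeZ mulrCA.
have pm0 : pointwise_mul phi 0 = 0.
  by apply: heckeI => x; rewrite pointwise_mulE// hecke0 mulr0.
rewrite pmD hclassD -[RHS]addr0; congr (_ + _); rewrite fgE.
rewrite (big_morph _ pmD pm0) hclass_sum big_seq big1// => c /lP[a [b cE]].
have -> : c.2 = hmul a b - hmul b a by apply: val_inj.
by rewrite pmZ hclassZ -scaleN1r pmD pmZ hclassD hclassZ hclass_pointwise_mulC// scaleN1r subrr scaler0.
Qed.

(** Three variables serve words of two and of three letters alike; for the former [f] ignores
    [t]. *)
Lemma uniform_locally_const3 (Y : Type) (f : (G * G) * G -> Y) (Om : set G) :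
  locally_const f -> compact Om ->
  \forall i \near \oo, forall y z t k k' k'', Om y -> Om z -> Om t -> K i k -> K i k' -> K i k'' ->
    f ((y * k, z * k'), t * k'')%g = f ((y, z), t).
Proof.
move=> lf cO.
pose m (p : ((G * G) * G) * ((G * G) * G)) :=
  ((p.1.1.1 * p.2.1.1, p.1.1.2 * p.2.1.2), p.1.2 * p.2.2)%g.
have c1 := @continuous_fst ((G * G) * G)%type ((G * G) * G)%type.
have c2 := @continuous_snd ((G * G) * G)%type ((G * G) * G)%type.
have d1 := @continuous_fst (G * G)%type G; have d2 := @continuous_snd (G * G)%type G.
have e1 := @continuous_fst G G; have e2 := @continuous_snd G G.
have mc : continuous m.
  apply: continuous_pair; first apply: continuous_pair; apply: continuous_mulg.
  - exact: continuous_comp2 (continuous_comp2 c1 d1) e1.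
  - exact: continuous_comp2 (continuous_comp2 c2 d1) e1.
  - exact: continuous_comp2 (continuous_comp2 c1 d1) e2.
  - exact: continuous_comp2 (continuous_comp2 c2 d1) e2.
  - exact: continuous_comp2 c1 d2.
  - exact: continuous_comp2 c2 d2.
have m1 p : m (p, ((1, 1), 1)%g) = p by case: p => -[x y] z; rewrite /m/= !mulg1.
have cO3 : compact ((Om `*` Om) `*` Om) by apply: compact_setX => //; exact: compact_setX.
pose L i := (K i `*` K i) `*` K i.
have hL (U : set ((G * G) * G)) : nbhs ((1, 1), 1)%g U -> \forall i \near \oo, L i `<=` U.
  move=> [[A B] [[[A1 A2] [/= h1 h2] hA] /= hB] AB].
  apply: filterS (filterI (filterI (KB h1) (KB h2)) (KB hB)) => i [[k1 k2] k3] [[x y] z] [[/= x1 y1] z1].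
  by apply: AB; split => /=; [apply: hA; split; [exact: k1|exact: k2]|exact: k3].
have := uniform_locally_const cO3 lf mc m1 hL; apply: filterS => i h y z t k k' k'' *.
exact: (h ((y, z), t) ((k, k'), k'')).
Qed.

(** * Idempotents graded by a locally constant cocycle *)

Section Engine.
Variable c : G -> G -> int.
Hypothesis cM : forall x h h', c x (h * h')%g = c x h + c (h^-1 * x * h)%g h'.
Hypothesis c_lc : locally_const (fun p : G * G => c p.1 p.2).
Let w x := c x x.
Hypothesis wX : forall x m, (0 < m)%N -> w (x ^+ m)%g = w x *+ m.

(** Conjugating by [x] carries x y to y x, and conjugating by [y] carries it back; the loop collects
    one value of [c] from each step. *)
Lemma cocycle_split x y : w (x * y)%g = c (x * y)%g x + c (y * x)%g y.
Proof. by rewrite /w cM mulKg. Qed.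

Lemma loop_classC x y : w (x * y)%g = w (y * x)%g.
Proof. by rewrite !cocycle_split addrC. Qed.

Lemma loop_lc : locally_const w.
Proof.
have := locally_const_comp (continuous_pair (@continuous_id G) (@continuous_id G)) c_lc.
exact.
Qed.

Definition level (mu : int) (x : G) : R := (w x == mu)%:R.

Lemma level_lc mu : locally_const (level mu).
Proof. exact: (locally_const1 (fun z : int => (z == mu)%:R : R) loop_lc). Qed.

Lemma level_class mu : class_function (level mu).
Proof. by move=> x y; rewrite /level loop_classC. Qed.

Definition weight (mu : int) (y z : G) : R := level mu (y * z)%g * (c (y * z)%g y)%:~R.

Lemma weight_lc mu : locally_const (fun p : G * G => weight mu p.1 p.2).
Proof.
have h1 : locally_const (fun p : G * G => level mu (p.1 * p.2)%g).
  exact: locally_const_comp mulc (@level_lc mu).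
have h2 : locally_const (fun p : G * G => c (p.1 * p.2)%g p.1).
  exact: locally_const_comp (continuous_pair mulc (@continuous_fst _ _)) c_lc.
exact: (locally_const2 *%R h1 (locally_const1 (fun z : int => z%:~R : R) h2)).
Qed.

Lemma weight2 mu y z : weight mu y z + weight mu z y = mu%:~R * level mu (y * z)%g.
Proof.
rewrite /weight (level_class _ z y) -mulrDr -rmorphD/= -cocycle_split mulrC.
by rewrite /level; case: eqP => [->|]; rewrite ?mulr1 ?mulr0.
Qed.

Lemma weight3 mu y z t : weight mu y (z * t)%g + weight mu z (t * y)%g + weight mu t (y * z)%g =
  mu%:~R * level mu (y * (z * t))%g.
Proof.
rewrite /weight.
have -> : level mu (z * (t * y))%g = level mu (y * (z * t))%g by rewrite mulgA level_class.
have -> : level mu (t * (y * z))%g = level mu (y * (z * t))%g by rewrite level_class mulgA.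
rewrite -!mulrDr -!rmorphD/=.
have -> : c (y * (z * t))%g y + c (z * (t * y))%g z + c (t * (y * z))%g t = w (y * (z * t))%g.
  rewrite cocycle_split -addrA; congr (_ + _); rewrite cM; congr (_ + _).
    by rewrite -mulgA.
  by rewrite -(mulgA z t y) mulKg -mulgA.
by rewrite mulrC /level; case: eqP => [->|]; rewrite ?mulr1 ?mulr0.
Qed.

(** This is the product set (s L)^(m+1): as in [word_product], [m] counts the letters after the
    first. *)
Fixpoint coset_power (L : set G) (s : G) (m : nat) (x : G) : Prop :=
  if m is m'.+1 then exists2 y, L (s^-1 * y)%g & coset_power L s m' (y^-1 * x)%g
  else L (s^-1 * x)%g.

Lemma nbhs_mulg (x y : G) (W : set G) : nbhs (x * y)%g W -> exists A B : set G,
  [/\ nbhs x A, nbhs y B & forall a b, A a -> B b -> W (a * b)%g].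
Proof.
move=> /(@mulc (x, y) _)[[A B] [/= Ax By] AB]; exists A, B; split=> // a b Aa Bb.
exact: (AB (a, b)).
Qed.

Lemma coset_power_near (s0 : G) m (W : set G) : nbhs (s0 ^+ m.+1)%g W ->
  \forall s \near s0 & i \near \oo, forall x, coset_power (K i) s m x -> W x.
Proof.
elim: m W => [|m IH] W.
  rewrite expg1 -{1}(mulg1 s0) => /nbhs_mulg[A [B [As B1 AB]]].
  exists (A, [set i | K i `<=` B]); first by split=> //; exact: KB.
  move=> [s i] [/= sA iB] x Kx; rewrite -[x](mulVKg s).
  by apply: AB => //; exact: iB.
rewrite expgS => /nbhs_mulg[A [B [As Bs AB]]].
move: As; rewrite -{1}(mulg1 s0) => /nbhs_mulg[A' [B' [As' B1 AB']]].
have [[C D] [/= Cs Di] CD] := IH _ Bs.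
exists (A' `&` C, [set i | K i `<=` B'] `&` D).
  by split; apply: filterI => //; exact: KB.
move=> [s i] [/= [sA sC] [iB iD]] x [y Ky h]; rewrite -[x](mulVKg y); apply: AB.
  by rewrite -[y](mulVKg s); apply: AB' => //; exact: iB.
exact: (CD (s, i)).
Qed.

(** Near a fixed s0, small cosets give products close to s0^(m+1), where [w] is constant equal to
    (m+1) w(s0). Compactness of [Om] makes the size of the subgroup uniform in [s]. *)
Lemma loop_coset_power_near (Om : set G) m : compact Om ->
  \forall i \near \oo, forall s x, Om s -> coset_power (K i) s m x -> w x = w s *+ m.+1.
Proof.
move=> cO.
have : \forall i \near \oo, Om `<=` (fun s => forall x, coset_power (K i) s m x -> w x = w s *+ m.+1).
  apply: ((compact_near_coveringP Om).1 cO _ _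
    (fun i s => forall x, coset_power (K i) s m x -> w x = w s *+ m.+1) eventually_filter) => s0 Os0.
  have [[A B] [/= As Bi] AB] := @coset_power_near s0 m [set x | w x = w (s0 ^+ m.+1)%g] (loop_lc _).
  exists (A `&` [set s | w s = w s0], B); first by split=> //; apply: filterI => //; exact: loop_lc.
  move=> [s i] [/= [sA ws] iB] x h.
  by have /= -> := AB (s, i) (conj sA iB) x h; rewrite wX// ws.
by apply: filterS => i h s x Os; exact: h.
Qed.

Section Idempotent.
Variables (n : nat) (e : 'I_n -> 'I_n -> hecke R G).
Hypothesis ee : forall i j, e i j = \sum_k hmul (e i k) (e k j).

Let V := 'I_n -> 'I_n -> hecke R G.

Definition mmul (X Y : V) : V := fun i j => \sum_k hmul (X i k) (Y k j).
Definition mtrace (X : V) : cocenter I := \sum_i hclass (X i i).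
Definition mpointwise (phi : G -> R) (X : V) : V := fun i j => pointwise_mul phi (X i j).

Lemma entry_sum (J : finType) (E : J -> R) (U : J -> V) i j :
  (\sum_k E k *: U k) i j = \sum_k E k *: U k i j.
Proof. by rewrite !fct_sumE. Qed.

Lemma mmul_suml (J : finType) (E : J -> R) (U : J -> V) Y :
  mmul (\sum_k E k *: U k) Y = \sum_k E k *: mmul (U k) Y.
Proof.
apply/funext => i; apply/funext => j; rewrite entry_sum /mmul.
under eq_bigr do rewrite entry_sum hmul_suml.
by rewrite exchange_big; apply: eq_bigr => k _; rewrite -scaler_sumr.
Qed.

Lemma mmul_sumr (J : finType) (E : J -> R) (U : J -> V) X :
  mmul X (\sum_k E k *: U k) = \sum_k E k *: mmul X (U k).
Proof.
apply/funext => i; apply/funext => j; rewrite entry_sum /mmul.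
under eq_bigr do rewrite entry_sum hmul_sumr.
by rewrite exchange_big; apply: eq_bigr => k _; rewrite -scaler_sumr.
Qed.

Lemma hmul_sum1l (J : finType) (U : J -> hecke R G) (f : hecke R G) :
  hmul (\sum_j U j) f = \sum_j hmul (U j) f.
Proof.
have := hmul_suml (fun=> 1) U f.
by under eq_bigr do rewrite scale1r; under [in RHS]eq_bigr do rewrite scale1r.
Qed.

Lemma hmul_sum1r (J : finType) (U : J -> hecke R G) (f : hecke R G) :
  hmul f (\sum_j U j) = \sum_j hmul f (U j).
Proof.
have := hmul_sumr (fun=> 1) U f.
by under eq_bigr do rewrite scale1r; under [in RHS]eq_bigr do rewrite scale1r.
Qed.

Lemma mmulA X Y Z : mmul X (mmul Y Z) = mmul (mmul X Y) Z.
Proof.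
apply/funext => i; apply/funext => j; rewrite /mmul.
under eq_bigr do rewrite hmul_sum1r; under [RHS]eq_bigr do rewrite hmul_sum1l.
rewrite exchange_big; apply: eq_bigr => k _; apply: eq_bigr => l _.
exact: hmulA.
Qed.

Lemma mtrace_sum (J : finType) (E : J -> R) (U : J -> V) :
  mtrace (\sum_k E k *: U k) = \sum_k E k *: mtrace (U k).
Proof.
rewrite /mtrace; under eq_bigr do rewrite entry_sum hclass_sum.
rewrite exchange_big; apply: eq_bigr => k _; rewrite scaler_sumr.
by apply: eq_bigr => i _; rewrite hclassZ.
Qed.

Lemma mtraceC X Y : mtrace (mmul X Y) = mtrace (mmul Y X).
Proof.
rewrite /mtrace /mmul; under eq_bigr do rewrite hclass_sum.
under [RHS]eq_bigr do rewrite hclass_sum.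
rewrite exchange_big; apply: eq_bigr => i _; apply: eq_bigr => j _; exact: hclassC.
Qed.

Lemma mpointwise_sum phi (J : finType) (E : J -> R) (U : J -> V) : locally_const phi ->
  mpointwise phi (\sum_k E k *: U k) = \sum_k E k *: mpointwise phi (U k).
Proof.
move=> lp; apply/funext => i; apply/funext => j.
by rewrite entry_sum /mpointwise entry_sum pointwise_mul_sum.
Qed.

Definition msupport (X : V) : set G := [set x | exists i j, X i j x != 0].

Lemma mpointwise_const phi a (X : V) : locally_const phi ->
  (forall x, msupport X x -> phi x = a) -> mpointwise phi X = a *: X.
Proof.
move=> lp h; apply/funext => i; apply/funext => j.
by apply: pointwise_mul_const => // x Xx; apply: h; exists i, j.
Qed.

Lemma mmul_support X Y x : msupport (mmul X Y) x ->
  exists2 y, msupport X y & msupport Y (y^-1 * x)%g.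
Proof.
move=> [i [j]]; rewrite hecke_sum => /eqP h.
have [k hk] : exists k, hmul (X i k) (Y k j) x != 0.
  apply: contrapT => /forallNP no; apply: h; apply: big1 => k _.
  by apply/eqP/negPn/negP; exact: no.
have [y [Xy Yy]] := hmul_support hk.
by exists y; [exists i, k|exists k, j].
Qed.

Lemma msupport_compact (X : V) : compact (msupport X).
Proof.
have -> : msupport X = \big[setU/set0]_(p : 'I_n * 'I_n) [set x | X p.1 p.2 x != 0].
  apply/seteqP; split=> [x [i [j Xx]]|x]; first by rewrite (bigD1 (i, j))//=; left.
  elim/big_ind: _ => //= [A A' hA hA' [/hA|/hA']//|[i j] _ Xx]; by exists i, j.
elim/big_ind: _ => [|A A'|p _]; [exact: compact0|exact: compactU|exact: hecke_compact].
Qed.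

Section Discretization.
Variables (L : set G) (hL : compact_open_subgroup L) (N : nat) (s : 'I_N -> G).
Hypothesis hs : coset_reps L (msupport e) s.
Hypothesis er : forall i j, right_invariant L (e i j).

Let B := (('I_n * 'I_n) * 'I_N)%type.
(** The letters of the words: a matrix unit together with a coset. Words are thus multiplied in the
    matrix algebra over the Hecke algebra, where [e] is idempotent. *)
Definition basis_coef (b : B) : R := e b.1.1 b.1.2 (s b.2).
Definition basis_elt (b : B) : V := fun i j =>
  if (i, j) == b.1 then coset_fun hL (s b.2) else 0.

Lemma basis_expansion : e = \sum_b basis_coef b *: basis_elt b.
Proof.
apply/funext => i; apply/funext => j; rewrite entry_sum.
rewrite {1}(coset_decomposition hL hs (er i j)); last by move=> x ex; exists i, j.
rewrite -(pair_bigA _ (fun p t => basis_coef (p, t) *: basis_elt (p, t) i j))/=.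
rewrite (bigD1 (i, j))//= [X in _ + X]big1 ?addr0; last first.
  move=> p /negPf pij; apply: big1 => t _.
  by rewrite /basis_elt/= eq_sym pij scaler0.
by apply: eq_bigr => t _; rewrite /basis_elt eqxx.
Qed.

Lemma basis_support b x : msupport (basis_elt b) x -> L ((s b.2)^-1 * x)%g.
Proof.
move=> [i [j]]; rewrite /basis_elt; case: ifP => _; last by rewrite hecke0 eqxx.
exact: subset_coset_fun.
Qed.

Lemma mmul_idem : e = mmul e e.
Proof. by apply/funext => i; apply/funext => j; exact: ee. Qed.

Lemma basis_expansion2 :
  e = \sum_b \sum_b' (basis_coef b * basis_coef b') *: mmul (basis_elt b) (basis_elt b').
Proof.
rewrite {1}mmul_idem {1}basis_expansion mmul_suml; apply: eq_bigr => b _.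
rewrite {1}basis_expansion mmul_sumr scaler_sumr.
by apply: eq_bigr => b' _; rewrite scalerA.
Qed.

Lemma basis_expansion3 :
  e = \sum_b \sum_b' \sum_b'' (basis_coef b * basis_coef b' * basis_coef b'') *:
        mmul (basis_elt b) (mmul (basis_elt b') (basis_elt b'')).
Proof.
rewrite {1}mmul_idem {1}basis_expansion mmul_suml; apply: eq_bigr => b _.
rewrite {1}basis_expansion2 pair_bigA mmul_sumr scaler_sumr [RHS]pair_bigA/=.
by apply: eq_bigr => -[b' b''] _; rewrite scalerA mulrA.
Qed.

Lemma basis_support2 b b' x : msupport (mmul (basis_elt b) (basis_elt b')) x ->
  exists k k', [/\ L k, L k' & x = (s b.2 * k * (s b'.2 * k'))%g].
Proof.
move=> /mmul_support[y /basis_support h /basis_support h'].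
exists ((s b.2)^-1 * y)%g, ((s b'.2)^-1 * (y^-1 * x))%g; split=> //.
by rewrite !mulVKg.
Qed.

Lemma basis_support3 b b' b'' x :
  msupport (mmul (basis_elt b) (mmul (basis_elt b') (basis_elt b''))) x ->
  exists k k' k'', [/\ L k, L k', L k'' & x = (s b.2 * k * (s b'.2 * k' * (s b''.2 * k'')))%g].
Proof.
move=> /mmul_support[y /basis_support h /basis_support2[k' [k'' [Lk' Lk'' yx]]]].
exists ((s b.2)^-1 * y)%g, k', k''; split=> //.
by rewrite -yx !mulVKg.
Qed.

Section CocycleArgument.
Variable mu : int.
Local Notation Om := (msupport e).
Hypothesis weight_inv2 : forall y z k, Om y -> Om z -> L k ->
  weight mu y (z * k)%g = weight mu y z.
Hypothesis weight_inv3 : forall y z t k k', Om y -> Om z -> Om t -> L k -> L k' ->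
  weight mu y (z * k * (t * k'))%g = weight mu y (z * t)%g.
Hypothesis level_inv2 : forall y z k k', Om y -> Om z -> L k -> L k' ->
  level mu (y * k * (z * k'))%g = level mu (y * z)%g.
Hypothesis level_inv3 : forall y z t k k' k'', Om y -> Om z -> Om t -> L k -> L k' -> L k'' ->
  level mu (y * k * (z * k' * (t * k'')))%g = level mu (y * (z * t))%g.

(** This is [cyclic_weight_eq0] for the letters above. [L] is small enough for levels and weights to
    be constant on the support of each word, so that they can be read off at the representatives
    [s]. *)
Lemma mtrace_level_eq0 : mu%:~R *: mtrace (mpointwise (level mu) e) = 0.
Proof.
have [sO _ _] := hs.
apply: (@cyclic_weight_eq0 R (V : lmodType R) (cocenter I : lmodType R) mmul mtrace
  mmul_sumr mmulA mtrace_sum mtraceC _ basis_coef basis_elt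
  (fun b b' => weight mu (s b.2) (s b'.2))
  (fun b b' => level mu (s b.2 * s b'.2)%g)
  (fun b b' b'' => weight mu (s b.2) (s b'.2 * s b''.2)%g)
  (fun b b' b'' => level mu (s b.2 * (s b'.2 * s b''.2))%g)).
- by move=> b b'; exact: weight2.
- by move=> b b' b''; exact: weight3.
- move=> b; have lw : locally_const (weight mu (s b.2)).
    have := locally_const_comp (continuous_pair (@cst_continuous G G (s b.2)) (@continuous_id G))
      (weight_lc mu).
    exact.
  (* With the first letter frozen, both sides are the same function multiple of [e], expanded once
     through [e] as a product of two factors and once directly. *)
  transitivity (mpointwise (weight mu (s b.2)) e).
    rewrite {1}basis_expansion2 pair_bigA [in RHS]pair_bigA mpointwise_sum//.
    apply: eq_bigr => -[b' b''] _ /=.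
    rewrite (mpointwise_const (a := weight mu (s b.2) (s b'.2 * s b''.2)%g)) ?scalerA//.
    by move=> x /basis_support2[k [k' [Lk Lk' ->]]]; exact: weight_inv3.
  rewrite {1}basis_expansion mpointwise_sum//; apply: eq_bigr => b' _.
  rewrite (mpointwise_const (a := weight mu (s b.2) (s b'.2))) ?scalerA//.
  by move=> x /basis_support h; rewrite -[x](mulVKg (s b'.2)); exact: weight_inv2.
- rewrite {1}basis_expansion2 [in RHS]pair_bigA mpointwise_sum; last exact: level_lc.
  rewrite mtrace_sum [LHS]pair_bigA/=; apply: eq_bigr => -[b b'] _ /=.
  rewrite (mpointwise_const (a := level mu (s b.2 * s b'.2)%g)).
  - by have := mtrace_sum (fun _ : 'I_1 => level mu (s b.2 * s b'.2)%g)
      (fun=> mmul (basis_elt b) (basis_elt b')); rewrite !big_ord1 => ->; rewrite scalerA.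
  - exact: level_lc.
  - by move=> x /basis_support2[k [k' [Lk Lk' ->]]]; exact: level_inv2.
- rewrite {1}basis_expansion3; under [in RHS]eq_bigr do rewrite pair_bigA.
  rewrite [in RHS]pair_bigA mpointwise_sum; last exact: level_lc.
  rewrite mtrace_sum; under eq_bigr do rewrite pair_bigA.
  rewrite [LHS]pair_bigA/=; apply: eq_bigr => -[b [b' b'']] _ /=.
  rewrite (mpointwise_const (a := level mu (s b.2 * (s b'.2 * s b''.2))%g)).
  - by have := mtrace_sum (fun _ : 'I_1 => level mu (s b.2 * (s b'.2 * s b''.2))%g)
      (fun=> mmul (basis_elt b) (mmul (basis_elt b') (basis_elt b''))); rewrite !big_ord1 => ->; rewrite scalerA.
  - exact: level_lc.
  - by move=> x /basis_support3[k [k' [k'' [Lk Lk' Lk'' ->]]]]; exact: level_inv3.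
Qed.

End CocycleArgument.

Lemma word_product_support b m x :
  msupport (word_product mmul (basis_elt b) (nseq m (basis_elt b)) : V) x ->
  coset_power L (s b.2) m x.
Proof.
elim: m x => [|m IH] x /=; first exact: basis_support.
move=> /mmul_support[y /basis_support h /IH h'].
by exists y.
Qed.

(** In the cocenter only constant words survive, and by assumption their supports avoid the level
    [mu]. *)
Lemma frobenius_level_eq0 p k (mu : int) : p \in [pchar R] ->
  (forall b x, coset_power L (s b) (p ^ k).-1 x -> w x != mu) ->
  hclass (pointwise_mul (level mu) (\sum_i e i i)) = 0.
Proof.
move=> pR hw; have [pp p0] := andP pR.
have Mp (y : cocenter I) : y *+ p = 0.
  by rewrite -scaler_nat (eqP p0) scale0r.
have := tr_idempotent_frobenius (M := cocenter I) mmul_suml mmul_sumr mmulA mtrace_sum mtraceC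
  basis_expansion mmul_idem k pp Mp.
rewrite -mtrace_sum /mtrace -!hclass_sum.
(* The Frobenius identity now compares the classes of two Hecke functions, so both may be
   truncated. *)
move=> /(hclass_pointwise_mul (@level_lc mu) (@level_class mu)) ->.
set X := \sum_b _; rewrite (@pointwise_mul_const _ 0) ?scale0r ?hclass0//; first exact: level_lc.
move=> x; rewrite /X => /eqP h; rewrite /level; case: eqP => // wx; case: h.
rewrite hecke_sum big1// => i _; rewrite entry_sum hecke_sum big1// => b _.
rewrite heckeZ; apply/eqP; rewrite mulf_eq0; apply/orP; right; apply/negPn/negP => hx.
have /hw : coset_power L (s b.2) (p ^ k).-1 x by apply: word_product_support; exists i, i.
by rewrite wx eqxx.
Qed.

End Discretization.

Lemma idempotent_level_eq0 mu : mu != 0 ->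
  hclass (pointwise_mul (level mu) (\sum_i e i i)) = 0.
Proof.
move=> mu0; have cO := @msupport_compact e.
have er : \forall i \near \oo, forall p : 'I_n * 'I_n, right_invariant (K i) (e p.1 p.2).
  by apply: filter_forall => p; exact: right_invariant_near.
have [[p pR]|no] := pselect (exists p, p \in [pchar R]).
  have [pp _] := andP pR; have p1 := prime_gt1 pp.
  have [i [hr hp]] := filter_ex (filterI er (loop_coset_power_near (p ^ absz mu).-1 cO)).
  have [N [s hs]] := coset_reps_exist (KP i) cO.
  apply: (@frobenius_level_eq0 _ (KP i) _ s hs (fun i j => hr (i, j)) p (absz mu)) => // b x hx.
  have [sO _ _] := hs; rewrite (hp _ _ (sO b) hx) prednK ?expn_gt0 ?(ltnW p1)//.
  (* The word length [p ^ absz mu] exceeds the absolute value of [mu], so the nonzero integer [mu]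
     is not a multiple of it. *)
  have := ltn_expl (absz mu) p1; move: (p ^ _)%N => q hq; apply/eqP => e1.
  have := congr1 absz e1; rewrite -mulr_natr abszM natz absz_nat => e2.
  case: (w (s b)) e1 e2 => [[|z]|z]; rewrite ?mul0rn; first by move=> e0; rewrite -e0 eqxx in mu0.
    by move=> _ /= e2; move: hq; rewrite -e2 mulSn; lia.
  by move=> _ /= e2; move: hq; rewrite -e2 mulSn; lia.
have muR : mu%:~R != 0 :> R.
  have : [pchar R] =i pred0 by move=> p; apply/negbTE/negP => pR; apply: no; exists p.
  move=> /pcharf0P h; case: mu mu0 => m m0; first by rewrite -pmulrn h.
  by rewrite NegzE mulrNz oppr_eq0 -pmulrn h.
have d1 := @continuous_fst (G * G)%type G; have d2 := @continuous_snd (G * G)%type G.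
have e1 := @continuous_fst G G; have e2 := @continuous_snd G G.
have c1 := continuous_comp2 d1 e1; have c2 := continuous_comp2 d1 e2.
have w2 : locally_const (fun p : (G * G) * G => weight mu p.1.1 p.1.2).
  exact: locally_const_comp (continuous_pair c1 c2) (weight_lc mu).
have w3 : locally_const (fun p : (G * G) * G => weight mu p.1.1 (p.1.2 * p.2)%g).
  exact: locally_const_comp (continuous_pair c1 (continuous_mulg c2 d2)) (weight_lc mu).
have l2 : locally_const (fun p : (G * G) * G => level mu (p.1.1 * p.1.2)%g).
  exact: locally_const_comp (continuous_mulg c1 c2) (level_lc mu).
have l3 : locally_const (fun p : (G * G) * G => level mu (p.1.1 * (p.1.2 * p.2))%g).
  exact: locally_const_comp (continuous_mulg c1 (continuous_mulg c2 d2)) (level_lc mu).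
have [i [hr [[hw2 hw3] [hl2 hl3]]]] := filter_ex (filterI er (filterI
  (filterI (uniform_locally_const3 w2 cO) (uniform_locally_const3 w3 cO))
  (filterI (uniform_locally_const3 l2 cO) (uniform_locally_const3 l3 cO)))).
have [N [s hs]] := coset_reps_exist (KP i) cO.
have K1 : K i 1%g by case: (KP i) => -[].
have := @mtrace_level_eq0 _ (KP i) _ s hs (fun i j => hr (i, j)) mu _ _ _ _.
rewrite /mtrace -hclass_sum => h.
have -> : pointwise_mul (level mu) (\sum_i e i i) = \sum_i mpointwise (level mu) e i i.
  have := pointwise_mul_sum (fun=> 1) (fun i => e i i) (@level_lc mu).
  by under eq_bigr do rewrite scale1r; under [in RHS]eq_bigr do rewrite scale1r.
apply: (scalerI muR); rewrite scaler0; apply: h.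
- by move=> y z k Oy Oz Kk; have := hw2 y z y 1%g k 1%g Oy Oz Oy K1 Kk K1; rewrite /= !mulg1.
- by move=> y z t k k' Oy Oz Ot Kk Kk'; have := hw3 y z t 1%g k k' Oy Oz Ot K1 Kk Kk'; rewrite /= !mulg1.
- by move=> y z k k' Oy Oz Kk Kk'; have := hl2 y z y k k' 1%g Oy Oz Oy Kk Kk' K1.
- by move=> y z t k k' k'' Oy Oz Ot Kk Kk' Kk''; have := hl3 y z t k k' k'' Oy Oz Ot Kk Kk' Kk''.
Qed.

Lemma hclass_idempotent_level0 :
  hclass (\sum_i e i i) = hclass (pointwise_mul (level 0) (\sum_i e i i)).
Proof.
set h := \sum_i e i i.
have c1 : continuous (fun p : G * G => (p.1 * p.2)%g) by exact: mulc.
have [i [hr hw]] := filter_ex (filterI (right_invariant_near h)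
  (uniform_locally_const (@hecke_compact h) loop_lc c1 (@mulg1 G) KB)).
have [N [s hs]] := coset_reps_exist (KP i) (@hecke_compact h).
have [sO sC _] := hs.
(* By right invariance [w] takes finitely many values on the support. The value 0 is added by hand
   so that the surviving term is present even if it is not among them. *)
pose l := undup (0 :: [seq w (s j) | j <- enum 'I_N]).
have hE : h = \sum_(mu <- l) pointwise_mul (level mu) h.
  apply: heckeI => x; rewrite hecke_sum.
  have [hx|hx] := eqVneq (h x) 0.
    by rewrite hx big1// => mu _; rewrite pointwise_mulE ?hx ?mulr0//; exact: level_lc.
  have [j jx] := sC x hx.
  have wx : w x = w (s j) by rewrite -[x](mulVKg (s j)); apply: (hw (s j)) => //; exact: sO.
  have wl : w x \in l.
    by rewrite mem_undup inE wx; apply/orP; right; apply/mapP; exists j => //; rewrite mem_enum.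
  rewrite (bigD1_seq (w x)) ?undup_uniq//= big1 ?addr0.
    by rewrite pointwise_mulE; [rewrite /level eqxx mul1r|exact: level_lc].
  move=> mu muw; rewrite pointwise_mulE; last exact: level_lc.
  by rewrite /level eq_sym (negPf muw) mul0r.
have l0 : 0 \in l by rewrite mem_undup inE eqxx.
rewrite {1}hE hclass_sum (bigD1_seq 0) ?undup_uniq//= big1 ?addr0// => mu mu0.
exact: idempotent_level_eq0.
Qed.

End Idempotent.

End Engine.

(** The level 0 reduction is applied to [c] and to [c'], which records the backward orbits; a
    function truncated by both lives on compact elements. *)
Lemma hclass_idempotent_compact (c : G -> G -> int) n (e : 'I_n -> 'I_n -> hecke R G) :
  (forall x h h', c x (h * h')%g = c x h + c (h^-1 * x * h)%g h') ->
  locally_const (fun p : G * G => c p.1 p.2) ->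
  (forall x m, (0 < m)%N -> c (x ^+ m)%g (x ^+ m)%g = c x x *+ m) ->
  (forall g, c g g = 0 -> c g^-1%g g^-1%g = 0 -> compact_element g) ->
  (forall i j, e i j = \sum_k hmul (e i k) (e k j)) ->
  compact_cocenter I (hclass (\sum_i e i i)).
Proof.
move=> cM clc cX cC ee.
have c1 y : c y 1%g = 0.
  have := cM y 1%g 1%g; rewrite !mulg1 invg1 mul1g => h.
  by apply: (addrI (c y 1%g)); rewrite addr0 -h.
(* This links the loop of [c'] at x to that of [c] at the inverse of x: they are opposite, so they
   vanish together. *)
have cV y : c y^-1%g y = - c y^-1%g y^-1%g.
  have := cM y^-1%g y^-1%g y; rewrite mulVg c1 invgK mulgV mul1g => h.
  by apply/eqP; rewrite -addr_eq0 addrC -h.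
pose c' x h := c x^-1%g h.
have c'M x h h' : c' x (h * h')%g = c' x h + c' (h^-1 * x * h)%g h'.
  by rewrite /c' cM !invgM invgK !mulgA.
have c'lc : locally_const (fun p : G * G => c' p.1 p.2).
  have d1 := @continuous_fst G G; have d2 := @continuous_snd G G.
  exact: locally_const_comp (continuous_pair (continuous_invg d1) d2) clc.
have c'X x m : (0 < m)%N -> c' (x ^+ m)%g (x ^+ m)%g = c' x x *+ m.
  by move=> m0; rewrite /c' !cV -expVgn cX// mulNrn.
have h1 := hclass_idempotent_level0 cM clc cX ee.
have h2 := hclass_idempotent_level0 c'M c'lc c'X ee.
have lc1 := level_lc clc 0; have lc2 := level_lc c'lc 0.
(* The equality of classes [h2] is itself truncated at level 0 of [c], which gives a representative
   truncated twice. *)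
rewrite h1 (hclass_pointwise_mul lc1 (level_class cM 0) h2).
eexists; last reflexivity; move=> g /=; rewrite !pointwise_mulE// /level.
have [cg|] := eqVneq (c g g) 0; last by rewrite mul0r eqxx.
have [c'g|] := eqVneq (c' g g) 0; last by rewrite mul0r mulr0 eqxx.
move=> _; apply: cC => //; apply/eqP; rewrite -oppr_eq0 -cV; exact/eqP.
Qed.

End Convolution.

End Hecke.

(** * Linear combinations of compactly represented classes *)

Section CompactCocenter.
Variables (R : fieldType) (G : groupWithTopologyType) (I : (G -> R^o) -> R).

Lemma compact_cocenter0 : compact_cocenter I 0.
Proof.
exists 0; first by move=> g; rewrite hecke0 eqxx.
have e0 : (0 : hecke R G) = 0 + 0 by rewrite addr0.
apply: (@addrI _ (cocenter_class I 0)).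
by rewrite -cocenter_classD addr0 addr0.
Qed.

Lemma compact_cocenterD x y :
  compact_cocenter I x -> compact_cocenter I y -> compact_cocenter I (x + y).
Proof.
move=> [f fc <-] [g gc <-]; exists (f + g); last by rewrite cocenter_classD.
move=> u; rewrite heckeD; have [->|fu _] := eqVneq (f u) 0; last exact: fc.
by rewrite add0r; exact: gc.
Qed.

Lemma compact_cocenterZ a x : compact_cocenter I x -> compact_cocenter I (a *: x).
Proof.
move=> [f fc <-]; exists (a *: f); last by rewrite -cocenter_scale_class.
move=> u; rewrite heckeZ; have [->|fu _] := eqVneq (f u) 0; last exact: fc.
by rewrite mulr0 eqxx.
Qed.

End CompactCocenter.

Theorem theorem0p2p3
  (F : localField)
  (Fbar : closedFieldType) (iota : {rmorphism F -> Fbar})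
  (Fbar_algebraic : forall x : Fbar, algebraicOver iota x)
  (GG : connectedReductiveGroup iota)
  (R : closedFieldType)
  (charR : residue_char F \notin [pchar R])
  (I : (rational_points GG -> R^o) -> R)
  (haarI : haar_integral I)
  (K0 : set (rational_points GG))
  (K0_pro_p : open_pro_p_subgroup (residue_char F) K0)
  (volK0 : I \1_K0 = 1) :
  (forall x : projSpace R (rational_points GG),
     compact_cocenter I (rank_map (residue_char F) I x)) /\
  (forall P : smoothRep R (rational_points GG),
     finitely_generated P -> projective P ->
     forall h : cocenter I, is_rank (residue_char F) P h ->
       compact_cocenter I h).
Proof.
have main P h : is_rank (residue_char F) P h -> compact_cocenter I h.
  move=> [n [L [e [_ [_ ee _] ->]]]].
  have [K0s K0o K0c _] := K0_pro_p.
  have [K [Ks Ko Kc KB]] := small_compact_subgroups K0s K0o K0c.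
  have KP i : compact_open_subgroup (K i) by split.
  apply: (@hclass_idempotent_compact R (rational_points GG)
    (@rational_mul_continuous _ _ _ GG) (@rational_inv_continuous _ _ _ GG) I haarI K KP KB
    (@rational_cocycle _ _ _ GG)).
  - exact: rational_cocycleM.
  - by move=> [x y]; exact: rational_cocycle_near.
  - exact: rational_cocycle_exp.
  - exact: compact_element_cocycle.
  move=> i j; apply: heckeI => x; rewrite ee fct_sumE hecke_sum.
  by [].
(* Both possible values of [xget], a rank and the default 0, lie in the compact part. *)
have rank_compact C : compact_cocenter I (rank_class (residue_char F) I C).
  rewrite /rank_class; case: xgetP => [h -> [P _ /main]|_] //.
  exact: compact_cocenter0.
split=> [x|P _ _ h /main //].
rewrite /rank_map; case: xgetP => [_ -> [n [s [_ _ ->]]]|_]; last exact: compact_cocenter0.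
elim/big_ind: _ => [|y z|i _]; first exact: compact_cocenter0.
  exact: compact_cocenterD.
exact: compact_cocenterZ.
Qed.
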